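(* Let $G$ be a finite abelian group and $K\le\mathrm{Aut}(G)$. Suppose that there exists a Sylow $p$-subgroup $P$ of $G$ such that (1) $K\cap\mathrm{Aut}(P)$ is an abelian group, (2) $P$ is the disjoint union of an orbit of $K\cap\mathrm{Aut}(P)$ and a $K$-invariant subgroup of $P$. Then each $K$-primitive $K$-invariant S-ring $\mathcal A$ over $G$ is either of rank $2$ or Cayley isomorphic to a cyclotomic S-ring over a field with $K$ going to the multiplications by nonzero elements of the field; the second alternative means: there exist a finite field $\mathbb F$, a subgroup $L\le K_{\mathbb F}$ and a group isomorphism $f:G\to\mathbb F^+$ such that $f^{-1}Kf=K_{\mathbb F}$ (maps composed from left to right, i.e. $K$ is carried by $f$ onto $K_{\mathbb F}$) and the image of $\mathcal A$ under the ring isomorphism $\mathbb Z[G]\to\mathbb Z[\mathbb F^+]$ induced by $f$ is the cyclotomic S-ring whose basic sets are the orbits of $L$ on $\mathbb F$.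
   Context: S-rings. Let $G$ be a finite group. For $X\subseteq G$ put $\xi(X)=\sum_{x\in X}x\in\mathbb Z[G]$. A subring $\mathcal A$ of the group ring $\mathbb Z[G]$ is an S-ring (Schur ring) over $G$ if it has a $\mathbb Z$-basis $\{\xi(X): X\in\mathcal S\}$, where $\mathcal S=\mathcal S(\mathcal A)$ is a family of pairwise disjoint nonempty subsets of $G$ with $\{1\}\in\mathcal S$, $\bigcup_{X\in\mathcal S}X=G$, and $X\in\mathcal S\Rightarrow X^{-1}\in\mathcal S$. The elements of $\mathcal S$ are the basic sets of $\mathcal A$. The rank of $\mathcal A$ is $\mathrm{rk}(\mathcal A)=\dim_{\mathbb Z}(\mathcal A)=|\mathcal S|$. A subgroup of $G$ is an $\mathcal A$-subgroup if it is a union of basic sets. For $K\le\mathrm{Aut}(G)$, the S-ring $\mathcal A$ is $K$-invariant if $\mathcal A^k=\mathcal A$ for every $k\in K$, where $\mathrm{Aut}(G)$ acts on $\mathbb Z[G]$ by linear extension (equivalently, each $k\in K$ permutes the basic sets; the individual basic sets need not be fixed). $\mathcal A$ is $K$-primitive if $\{1\}$ and $G$ are the only $K$-invariant $\mathcal A$-subgroups of $G$. Two S-rings $\mathcal A$ over $G$ and $\mathcal A'$ over $G'$ are Cayley isomorphic if some group isomorphism $f:G\to G'$ induces a ring isomorphism $\mathbb Z[G]\to\mathbb Z[G']$ taking $\mathcal A$ to $\mathcal A'$. For a Sylow $p$-subgroup $P$ of the finite abelian group $G$, write $G=P\times Q$ with $Q$ the product of the Sylow $q$-subgroups for $q\ne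 p$. $\mathrm{Aut}(P)$ is regarded as the subgroup of $\mathrm{Aut}(G)$ consisting of the automorphisms acting trivially on $Q$; $K\cap\mathrm{Aut}(P)$ is understood in this sense. For a finite field $\mathbb F$ with additive group $\mathbb F^+$, $K_{\mathbb F}\le\mathrm{Aut}(\mathbb F^+)$ denotes the group of all maps $x\mapsto ux$, $u\in\mathbb F\setminus\{0\}$. A cyclotomic S-ring over $\mathbb F$ is an S-ring over the group $\mathbb F^+$ whose basic sets are the orbits on $\mathbb F$ of some subgroup of $K_{\mathbb F}$. *)

(* Defs.v *)
From HB Require Import structures.
From mathcomp Require Import all_boot all_order all_algebra.
From mathcomp Require Import all_fingroup all_solvable all_field.

Set Implicit Arguments.
Unset Strict Implicit.
Unset Printing Implicit Defensive.

Import GroupScope GRing.Theory.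
Local Open Scope ring_scope.

(* The integral group ring Z[gT]: [a g] is the coefficient of [g] in [a].     *)
(* It is an alias, because [{ffun gT -> int}] itself carries the pointwise    *)
(* product.                                                                   *)
Definition int_group_ring (gT : finGroupType) : Type := {ffun gT -> int}.

Section IntGroupRing.
Variable gT : finGroupType.
Local Notation ZG := (int_group_ring gT).

HB.instance Definition _ := GRing.Zmodule.copy ZG {ffun gT -> int}.

Definition gr_one : ZG := [ffun g : gT => (g == 1%g)%:R].
Definition gr_mul (a b : ZG) : ZG :=
  [ffun g : gT => \sum_(h : gT) a h * b (h^-1 * g)%g].

Fact gr_mulA : associative gr_mul.
Proof.
move=> a b c; apply/ffunP=> g; rewrite !ffunE.
under eq_bigr => h _ do rewrite ffunE big_distrr /=.
under [RHS]eq_bigr => h _ do rewrite ffunE big_distrl /=.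
rewrite [RHS]exchange_big /=; apply: eq_bigr => h _.
rewrite [RHS](reindex_inj (mulgI h)) /=; apply: eq_bigr => k _.
by rewrite mulrA mulKg invMg mulgA.
Qed.

Fact gr_mul1 : left_id gr_one gr_mul.
Proof.
move=> a; apply/ffunP=> g; rewrite ffunE (bigD1 1%g) //= big1 ?addr0.
  by rewrite ffunE eqxx mul1r invg1 mul1g.
by move=> h /negPf nh; rewrite ffunE nh mul0r.
Qed.

Fact gr_mulr1 : right_id gr_one gr_mul.
Proof.
move=> a; apply/ffunP=> g; rewrite ffunE (bigD1 g) //= big1 ?addr0.
  by rewrite ffunE mulVg eqxx mulr1.
by move=> h nh; rewrite ffunE -eq_mulVg1 (negPf nh) mulr0.
Qed.

Fact gr_mulDl : left_distributive gr_mul +%R.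
Proof.
move=> a b c; apply/ffunP=> g; rewrite !ffunE -big_split /=.
by apply: eq_bigr => h _; rewrite ffunE mulrDl.
Qed.

Fact gr_mulDr : right_distributive gr_mul +%R.
Proof.
move=> a b c; apply/ffunP=> g; rewrite !ffunE -big_split /=.
by apply: eq_bigr => h _; rewrite ffunE mulrDr.
Qed.

Fact gr_one_neq0 : gr_one != 0.
Proof. by apply/eqP => /ffunP/(_ 1%g); rewrite !ffunE eqxx. Qed.

HB.instance Definition _ := GRing.Zmodule_isNzRing.Build ZG
  gr_mulA gr_mul1 gr_mulr1 gr_mulDl gr_mulDr gr_one_neq0.

Definition xi (X : {set gT}) : ZG := [ffun g : gT => (g \in X)%:R].

Definition is_Zbasis (A : {pred ZG}) (S : {set {set gT}}) : Prop :=
  [/\ forall X, X \in S -> xi X \in A,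
      forall a, a \in A ->
        exists c : {set gT} -> int, a = \sum_(X in S) xi X *~ c X
    & forall c : {set gT} -> int, \sum_(X in S) xi X *~ c X = 0 ->
        forall X, X \in S -> c X = 0].

End IntGroupRing.

(* S-rings over the group of all elements of [gT]. The basic sets are         *)
(* determined by the subring: they are the minimal nonempty X with xi X in it.*)
Record sring (gT : finGroupType) := SRing {
  sring_pred : {pred int_group_ring gT};
  basic_sets : {set {set gT}};
  sring_subring : subring_closed sring_pred;
  sring_basis : is_Zbasis sring_pred basic_sets;
  basic_sets_partition : partition basic_sets [set: gT];
  basic_sets1 : [set 1%g] \in basic_sets;
  basic_setsV : forall X, X \in basic_sets -> X^-1%g \in basic_sets
}.

Definition rk (gT : finGroupType) (A : sring gT) : nat := #|basic_sets A|.

Definition Asubgroup (gT : finGroupType) (A : sring gT) (H : {group gT}) :=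
  exists2 T : {set {set gT}}, T \subset basic_sets A & H = cover T :> {set gT}.

Definition gr_map (gT rT : finGroupType) (f : gT -> rT)
    (a : int_group_ring gT) : int_group_ring rT :=
  \sum_(x : gT) xi [set f x] *~ a x.

(* The image of A under the map of group rings induced by f is B. *)
Definition sring_image (gT rT : finGroupType) (f : gT -> rT)
    (A : sring gT) (B : sring rT) : Prop :=
  forall b, b \in sring_pred B <->
            exists2 a, a \in sring_pred A & b = gr_map f a.

Definition K_invariant (gT : finGroupType) (K : {group {perm gT}})
    (A : sring gT) : Prop :=
  forall k : {perm gT}, k \in K -> sring_image k A A.

Definition K_primitive (gT : finGroupType) (K : {group {perm gT}})
    (A : sring gT) : Prop :=
  forall H : {group gT}, Asubgroup A H -> [acts K, on H | 'P] ->
    H :=: 1%g \/ H :=: [set: gT].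

(* K :&: Aut(P), for P the Sylow p-subgroup of the abelian group gT: the      *)
(* product of the other Sylow subgroups is the p'-core of gT.                 *)
Definition cap_Aut_Sylow (gT : finGroupType) (K : {group {perm gT}}) (p : nat) :
    {group {perm gT}} :=
  'C_K('O_p^'([set: gT]) | 'P)%G.

(* f^-1 K f, with maps composed from left to right (f bijective). *)
Definition transport_perms (gT rT : finGroupType) (f : gT -> rT)
    (K : {set {perm gT}}) : {set {perm rT}} :=
  [set s : {perm rT} | [exists k in K, [forall x, s (f x) == f (k x)]]].

(* {unit F} acts on F by multiplication ('U). *)
Definition K_field (F : finFieldType) : {group {perm F}} :=
  (actperm 'U @* [set: {unit F}])%G.

Lemma K_fieldP (F : finFieldType) (s : {perm F}) :
  reflect (exists2 u : F, u != 0 & forall x, s x = u * x) (s \in K_field F).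
Proof.
apply: (iffP morphimP) => [[u _ _ ->] | [u nzu su]].
  exists (val u); first by rewrite -unitfE (valP u).
  by move=> x; rewrite actpermE /= FinRing.unit_actE mulrC.
rewrite -unitfE in nzu; exists (FinRing.Unit nzu); rewrite ?inE //.
by apply/permP=> x; rewrite actpermE /= FinRing.unit_actE mulrC su.
Qed.

(* B is the cyclotomic S-ring over F whose basic sets are the orbits of L. *)
Definition cyclotomic_sring (F : finFieldType) (L : {group {perm F}})
    (B : sring F) : Prop :=
  L \subset K_field F /\ basic_sets B = [set orbit 'P L x | x in [set: F]].

(* Main.v *)
(* Write Q for the p'-core of G, so that G = P x Q, put M = K :&: Aut(P), and
   let x^M = P \ H. As M is abelian, P is the additive group of a finite local
   commutative ring with unit group M (orbit of the identity x) and maximal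
   ideal H. K-primitivity is used twice: an A-set inside a proper K-invariant
   subgroup lies in {1}, hence every nontrivial basic set meets (P \ H)Q; and a
   nonempty A-set stable under a nontrivial K-invariant subgroup is all of G.

   If Q <> 1, we use the S-ring of the M-invariant elements of A and its dual.
   Let theta be a character trivial on P but not on Q. Schur's p-power argument
   on the dual side shows that p divides the number of members of the dual basic
   set of theta that agree with theta on Q. The p-group 1 + H acts on these and
   fixes theta, hence fixes another one, which is trivial on H but not on P.
   Comparing the values of these two characters on an M-invariant A-set X shows
   that x y \in X does not depend on y \in Q, so all M-invariant nontrivial
   A-sets meet, and the rank is 2.

   If Q = 1 and H <> 1, the nontrivial basic sets X are permuted transitively
   by K = M, so their number is prime to p and 1 + H fixes each of them. Hence
   X \ H is a union of H-cosets, and counting the factorizations in X of an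
   element of X :&: H and of an element of X \ H modulo |H| gives a
   contradiction unless the rank is 2.

   If Q = 1 and H = 1, the local ring is a field on which K acts by
   multiplications. *)
From HB Require Import structures.
Require Import Defs.
From mathcomp Require Import all_boot all_order all_algebra.
From mathcomp Require Import all_fingroup all_solvable all_field.
From mathcomp Require Import all_character.

Set Implicit Arguments.
Unset Strict Implicit.
Unset Printing Implicit Defensive.

Import GroupScope GRing.Theory Num.Theory.

(** * Basic sets and A-sets *)

Lemma xi_mulz (gT : finGroupType) (X : {set gT}) (z : int) g :
  (xi X *~ z)%R g = if g \in X then z else 0%R.
Proof.
have -> : (xi X *~ z)%R g = ((g \in X)%:R *~ z)%R.
  case: z => n; first by rewrite -!pmulrn ffunMnE ffunE.
  by rewrite NegzE !mulrNz -!pmulrn ffunE ffunMnE ffunE.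
by case: ifP; rewrite ?mul0rz ?intz.
Qed.

Lemma gr_mapE (gT rT : finGroupType) (f : gT -> rT) (f' : rT -> gT)
    (a : int_group_ring gT) y :
  cancel f f' -> cancel f' f -> gr_map f a y = a (f' y).
Proof.
move=> fK f'K; rewrite sum_ffunE (bigD1 (f' y)) //= big1 ?addr0 => [|x neqx].
  by rewrite xi_mulz inE f'K eqxx.
rewrite xi_mulz inE; case: eqP => // def_y.
by rewrite def_y fK eqxx in neqx.
Qed.

Section SringBasics.

Variables (gT : finGroupType) (A : sring gT).
Implicit Types (g h : gT) (X Y Z : {set gT}).

Definition sblock g : {set gT} := pblock (basic_sets A) g.

(** The value type is left open so that one notion covers membership in a set, factorization counts,
    elements of the group ring and [algC]-valued functions. *)
Definition sconst (V : Type) (a : gT -> V) : Prop :=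
  forall g h, h \in sblock g -> a h = a g.

Definition sset X : Prop := sconst (fun g => g \in X).

Lemma mem_sblock g : g \in sblock g.
Proof.
have /and3P[/eqP covS _ _] := basic_sets_partition A.
by rewrite mem_pblock covS inE.
Qed.

Lemma sblock_basic g : sblock g \in basic_sets A.
Proof.
have /and3P[/eqP covS _ _] := basic_sets_partition A.
by rewrite pblock_mem // covS inE.
Qed.

Lemma sblock_def X g : X \in basic_sets A -> g \in X -> sblock g = X.
Proof.
by have /and3P[_ tiS _] := basic_sets_partition A; apply: def_pblock.
Qed.

Lemma sblock_eq g h : h \in sblock g -> sblock h = sblock g.
Proof. exact/sblock_def/sblock_basic. Qed.

Lemma sblock_sym g h : (h \in sblock g) = (g \in sblock h).
Proof. by apply/idP/idP=> /sblock_eq ->; apply: mem_sblock. Qed.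

Lemma basicP X :
  reflect (exists g, X = sblock g) (X \in basic_sets A).
Proof.
apply: (iffP idP) => [SX | [g ->]]; last exact: sblock_basic.
have /and3P[_ _ nS0] := basic_sets_partition A.
have [X0 | [g Xg]] := set_0Vmem X; first by rewrite -X0 SX in nS0.
by exists g; rewrite (sblock_def SX Xg).
Qed.

Lemma sblock1 : sblock 1 = [set 1].
Proof. by apply: sblock_def (basic_sets1 A) _; rewrite inE. Qed.

Lemma sset_sub X g : sset X -> g \in X -> sblock g \subset X.
Proof. by move=> sX Xg; apply/subsetP=> h /sX ->. Qed.

Lemma sset_sblock g : sset (sblock g).
Proof.
move=> h k hk; rewrite (sblock_sym g k) (sblock_sym g h).
by rewrite (sblock_eq hk).
Qed.

Lemma sset1 : sset [set 1].
Proof. by rewrite -sblock1; apply: sset_sblock. Qed.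

Lemma sset_bigcup (I : finType) (D : {set I}) (F : I -> {set gT}) :
  (forall i, i \in D -> sset (F i)) -> sset (\bigcup_(i in D) F i).
Proof.
move=> sF g h gh; apply/bigcupP/bigcupP=> [] [i Di Fi]; exists i => //.
  by rewrite -(sF i Di g h gh).
by rewrite (sF i Di g h gh).
Qed.

Lemma sset_bigcap (I : finType) (D : {set I}) (F : I -> {set gT}) :
  (forall i, i \in D -> sset (F i)) -> sset (\bigcap_(i in D) F i).
Proof.
move=> sF g h gh; apply/bigcapP/bigcapP=> FD i Di.
  by rewrite -(sF i Di g h gh) FD.
by rewrite (sF i Di g h gh) FD.
Qed.

Local Notation ZG := (int_group_ring gT).

(** A combination of the [xi X] has equal coefficients on each basic set; conversely, the common
    value on each basic set supplies the coefficients. This turns the subring axioms into statements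
    about functions. *)
Lemma in_sringP (a : ZG) : a \in sring_pred A <-> sconst a.
Proof.
have [Sxi Sspan _] := sring_basis A.
have Sclosed := sring_subring A.
have [A1 AB AM] := Sclosed.
have A0 : 0%R \in sring_pred A by rewrite -(subrr 1%R) AB.
have AN b : b \in sring_pred A -> (- b)%R \in sring_pred A.
  by move=> Ab; rewrite -sub0r AB.
have AD b c : b \in sring_pred A -> c \in sring_pred A ->
    (b + c)%R \in sring_pred A.
  by move=> Ab Ac; rewrite -[c]opprK AB ?AN.
split=> [/Sspan[c ->] g h gh | sa].
  rewrite !sum_ffunE; apply: eq_bigr => X SX.
  have eqX : (h \in X) = (g \in X).
    by have [k defX] := basicP _ SX; rewrite defX; apply: sset_sblock gh.
  by rewrite !xi_mulz eqX.
(* Since [a] is constant on [X], its value there can be read off at [repr X]. *)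
have -> : a = (\sum_(X in basic_sets A) xi X *~ a (repr X))%R.
  apply/ffunP=> g; rewrite sum_ffunE (bigD1 (sblock g)) ?sblock_basic //=.
  rewrite big1 ?addr0 => [|X /andP[SX neqX]]; rewrite xi_mulz.
    by rewrite mem_sblock; apply/esym/sa/(mem_repr g)/mem_sblock.
  by case: ifP => // Xg; rewrite (sblock_def SX Xg) eqxx in neqX.
elim/big_ind: _ => // X SX; have AX := Sxi X SX.
have An n : (xi X *+ n)%R \in sring_pred A.
  by elim: n => [|n IHn]; rewrite ?mulr0n // mulrS AD.
by case: (a _) => n; rewrite ?NegzE ?mulrNz -?pmulrn ?AN ?An.
Qed.

Lemma xi_in_sring X : xi X \in sring_pred A <-> sset X.
Proof.
split=> [/in_sringP cX g h gh | sX].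
  by have /eqP := cX g h gh; rewrite !ffunE; do 2!case: (_ \in X).
by apply/in_sringP=> g h gh; rewrite !ffunE (sX g h gh).
Qed.

(** The count is the coefficient of [g] in [xi X * xi Y], and this product lies in [A]. *)
Lemma sset_count X Y : sset X -> sset Y ->
  sconst (fun g => #|[set h in X | h^-1 * g \in Y]|).
Proof.
move=> /xi_in_sring AX /xi_in_sring AY g h gh.
have [_ _ AM] := sring_subring A.
have /in_sringP/(_ g h gh) := AM _ _ AX AY.
have xiM y : (xi X * xi Y)%R y = #|[set h in X | (h^-1 * y)%g \in Y]|%:R%R.
  rewrite [LHS]ffunE -sum1_card natr_sum [RHS]big_mkcond /=.
  apply: eq_bigr => k _; rewrite !ffunE inE.
  by case: (k \in X); rewrite ?mul0r // mul1r; case: (_ \in Y).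
by rewrite !xiM => /eqP; rewrite eqr_nat => /eqP.
Qed.

Lemma sset_inv X : sset X -> sset X^-1.
Proof.
move=> sX g h gh; rewrite !inE; apply: sX.
rewrite -[g in sblock g]invgK in gh.
have /basic_setsV SV := sblock_basic g^-1.
have gV: g \in (sblock g^-1)^-1 by rewrite inE mem_sblock.
by move: gh; rewrite invgK (sblock_def SV gV) inE.
Qed.

(** Closure of [A] under products, extended from integer to arbitrary coefficients: the convolution
    is a combination of the counts of [sset_count], with one term for each pair of basic sets. *)
Lemma sconst_conv (R : comNzRingType) (a b : gT -> R) : sconst a -> sconst b ->
  sconst (fun g => \sum_h a h * b (h^-1 * g)%g)%R.
Proof.
move=> sa sb g h gh.
have split_conv y : (\sum_k a k * b (k^-1 * y)%g)%R =
   (\sum_(X in basic_sets A) \sum_(Y in basic_sets A)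
      (a (repr X) * b (repr Y)) *+ #|[set k in X | (k^-1 * y)%g \in Y]|)%R.
  have/and3P[/eqP covS tiS _] := basic_sets_partition A.
  transitivity (\sum_(k in cover (basic_sets A)) a k * b (k^-1 * y)%g)%R.
    by apply: eq_bigl => k; rewrite covS inE.
  rewrite big_trivIset //=; apply: eq_bigr => X SX.
  transitivity (\sum_(k in X) \sum_(Y in basic_sets A)
       (if (k^-1 * y)%g \in Y then a (repr X) * b (repr Y) else 0))%R.
    apply: eq_bigr => k Xk.
    rewrite (bigD1 (sblock (k^-1 * y))) ?sblock_basic //= mem_sblock.
    rewrite big1 ?addr0 => [|Y /andP[SY neqY]]; last first.
      case: ifP => // Yk; by rewrite (sblock_def SY Yk) eqxx in neqY.
    congr (_ * _)%R; apply: esym.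
      rewrite -(sblock_def SX Xk); apply/sa/(mem_repr k)/mem_sblock.
    by apply/sb/(mem_repr (k^-1 * y))/mem_sblock.
  rewrite exchange_big /=; apply: eq_bigr => Y SY.
  rewrite -big_mkcondr /= -sumr_const; apply: eq_bigl => k.
  by rewrite inE.
rewrite !split_conv; apply: eq_bigr => X SX; apply: eq_bigr => Y SY.
have [x defX] := basicP _ SX; have [y defY] := basicP _ SY.
congr (_ *+ _)%R; apply: (@sset_count X Y); rewrite ?defX ?defY //.
  exact: sset_sblock.
exact: sset_sblock.
Qed.

Lemma sset_Asubgroup (H : {group gT}) : sset H -> Asubgroup A H.
Proof.
move=> sH; exists [set X in basic_sets A | X \subset H].
  by apply/subsetP=> X; rewrite inE => /andP[].
apply/setP=> g; apply/idP/bigcupP=> [Hg | [X]]; last first.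
  by rewrite inE => /andP[_ /subsetP]; apply.
by exists (sblock g); rewrite ?mem_sblock // inE sblock_basic sset_sub.
Qed.

(** The number of factorizations through the two blocks is constant on the block of [g * h] and
    positive at [g * h] itself. *)
Lemma sblock_mul g h : sblock (g * h) \subset sblock g * sblock h.
Proof.
apply/subsetP=> y ghy.
have := @sset_count (sblock g) (sblock h) (sset_sblock g) (sset_sblock h) _ _ ghy.
move=> eq_n; have: 0 < #|[set k in sblock g | k^-1 * y \in sblock h]|.
  by rewrite eq_n card_gt0; apply/set0Pn; exists g; rewrite inE mulKg !mem_sblock.
rewrite card_gt0 => /set0Pn[k]; rewrite inE => /andP[gk hk].
by apply/mulsgP; exists k (k^-1 * y); rewrite ?mulKVg.
Qed.

(** The elements whose whole block lies in [<<X>>] form a subgroup by [sblock_mul], and this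
    subgroup contains [X]. *)
Lemma sset_gen X : sset X -> sset <<X>>.
Proof.
move=> sX; pose N := [set g | sblock g \subset <<X>>].
have gN: group_set N.
  apply/group_setP; split=> [|g h]; first by rewrite inE sblock1 sub1G.
  rewrite !inE => gX hX; apply: subset_trans (sblock_mul g h) _.
  by rewrite -(mulGid <<X>>%G) mulgSS.
have sXN: <<X>> \subset Group gN.
  rewrite gen_subG; apply/subsetP=> g Xg.
  by rewrite inE (subset_trans (sset_sub sX Xg)) ?subset_gen.
move=> g h gh; apply/idP/idP=> [hX | gX].
  have /(subsetP sXN) := hX; rewrite inE => /subsetP; apply.
  by rewrite (sblock_eq gh) mem_sblock.
by have /(subsetP sXN) := gX; rewrite inE => /subsetP; apply.
Qed.

Definition stabr X : {set gT} := [set g | X :* g == X].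

Lemma stabr_group_set X : group_set (stabr X).
Proof.
apply/group_setP; split=> [|g h]; first by rewrite inE mulg1.
by rewrite !inE rcosetM => /eqP-> /eqP->.
Qed.

Canonical stabr_group X := Group (stabr_group_set X).

(** This exhibits the stabilizer as a level set of a factorization count; by [sset_count] it is then
    an A-set whenever [X] is one. *)
Lemma mem_stabr X g : (g \in stabr X) = (#|[set h in X^-1 | h^-1 * g \in X]| == #|X|).
Proof.
have -> : [set h in X^-1 | h^-1 * g \in X] = (X :&: X :* g^-1)^-1.
  by apply/setP=> h; rewrite !inE mem_rcoset invgK.
rewrite card_invg !inE; apply/eqP/eqP=> [defX | eqX].
  by rewrite -{2}defX rcosetK setIid.
have sXg: X \subset X :* g^-1.
  rewrite -{1}(_ : X :&: X :* g^-1 = X) ?subsetIr //; apply/eqP.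
  by rewrite eqEcard subsetIl eqX /=.
have /eqP eqXX: X == X :* g^-1 by rewrite eqEcard sXg card_rcoset /=.
by rewrite {1}eqXX rcosetKV.
Qed.

Lemma sset_stabr X : sset X -> sset (stabr X).
Proof.
move=> sX g h gh; rewrite !mem_stabr.
by rewrite (sset_count (sset_inv sX) sX gh).
Qed.

End SringBasics.

Lemma abelianT_mulgC (gT : finGroupType) :
  abelian [set: gT] -> commutative (@mulg gT).
Proof. by move=> abT g h; apply: (centsP abT); rewrite inE. Qed.

Lemma actsPerm (gT : finGroupType) (K : {group {perm gT}}) (X : {set gT}) :
  reflect (forall k g, k \in K -> g \in X -> k g \in X) [acts K, on X | 'P].
Proof.
apply: (iffP actsP) => [actK k g Kk Xg | actK k Kk g].
  by have := actK k Kk g; rewrite /= apermE Xg.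
rewrite /= apermE; apply/idP/idP=> [Xkg | ]; last exact: actK.
by rewrite -(permK k g); apply: actK; rewrite ?groupV.
Qed.

Lemma stabrP (gT : finGroupType) (X : {set gT}) y :
  reflect (forall g, g \in X -> g * y \in X) (y \in stabr X).
Proof.
rewrite inE; apply: (iffP eqP) => [eqX g Xg | sX].
  by rewrite -eqX mem_rcoset mulgK.
apply/eqP; rewrite eqEcard card_rcoset leqnn andbT.
by apply/subsetP=> g; rewrite mem_rcoset => /sX; rewrite mulgKV.
Qed.

(** * Invariant S-rings and the two uses of K-primitivity *)

Section InvariantSring.

Variables (gT : finGroupType) (A : sring gT) (K : {group {perm gT}}).
Hypotheses (sKAut : K \subset Aut [set: gT]) (invK : K_invariant K A).
Hypothesis primK : K_primitive K A.
Implicit Types (g h : gT) (k : {perm gT}) (X Y Z : {set gT}).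

Lemma KautM k : k \in K -> {morph k : g h / g * h}.
Proof.
move=> /(subsetP sKAut)/Aut_morphic/morphicP kM g h.
by apply: kM; rewrite inE.
Qed.

Lemma Kaut1 k : k \in K -> k 1 = 1.
Proof.
by move=> Kk; apply: (mulgI (k 1)); rewrite -KautM // !mulg1.
Qed.

Lemma mem_permI k X g : (k g \in k @: X) = (g \in X).
Proof. exact/mem_imset/perm_inj. Qed.

Lemma sset_perm k X : k \in K -> sset A X -> sset A (k @: X).
Proof.
move=> Kk /xi_in_sring AX; apply/xi_in_sring.
apply/(invK Kk); exists (xi X) => //; apply/ffunP=> g.
rewrite (gr_mapE _ _ (permK k) (permKV k)) !ffunE.
by rewrite -{1}[g](permKV k) mem_permI.
Qed.

Lemma sblock_perm k g : k \in K -> sblock A (k g) = k @: sblock A g.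
Proof.
have sub l y : l \in K -> sblock A (l y) \subset l @: sblock A y.
  by move=> Kl; rewrite sset_sub ?mem_permI ?mem_sblock //; apply/sset_perm/sset_sblock.
move=> Kk; apply/eqP; rewrite eqEcard sub //= card_imset; last exact: perm_inj.
(* The inclusion for [k^-1] at the point [k g] gives the reverse inequality of cardinalities. *)
have := subset_leq_card (sub k^-1 (k g) _).
by rewrite permK groupV card_imset; [exact | exact: perm_inj].
Qed.

Lemma sset_bigcup_perm (L : {group {perm gT}}) X : L \subset K -> sset A X ->
  sset A (\bigcup_(k in L) k @: X).
Proof.
move=> /subsetP sLK sX; apply: sset_bigcup => k Lk.
by apply: sset_perm => //; apply: sLK.
Qed.

Lemma bigcup_permP (L : {group {perm gT}}) X k g : k \in L ->
  (k g \in \bigcup_(k in L) k @: X) = (g \in \bigcup_(k in L) k @: X).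
Proof.
move=> Lk; apply/bigcupP/bigcupP=> [] [l Ll /imsetP[x Xx def_g]].
  exists (l * k^-1); first by rewrite groupM ?groupV.
  by apply/imsetP; exists x; rewrite // permM -def_g permK.
exists (l * k); first by rewrite groupM.
by apply/imsetP; exists x; rewrite // permM -def_g.
Qed.

Lemma sub_bigcup_perm (L : {group {perm gT}}) X :
  X \subset \bigcup_(k in L) k @: X.
Proof.
apply/subsetP=> g Xg; apply/bigcupP; exists 1; rewrite ?group1 //.
by rewrite -[g]perm1 mem_permI.
Qed.

(** The K-translates of [X] generate a K-invariant A-subgroup inside [W], which K-primitivity forces
    to be trivial. *)
Lemma primitive_sub (W : {group gT}) X :
    [acts K, on W | 'P] -> W != [set: gT] :> {set gT} ->
  sset A X -> X \subset W -> X \subset [set 1].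
Proof.
move=> /actsPerm actW properW sX sXW.
pose D := \bigcup_(k in K) k @: X.
have sDW: D \subset W.
  apply/bigcupsP=> k Kk; apply/subsetP=> _ /imsetP[g Xg ->].
  by rewrite actW // (subsetP sXW).
have sD: sset A <<D>> by apply/sset_gen/sset_bigcup_perm.
have actD: [acts K, on <<D>> | 'P].
  apply/actsPerm=> k g Kk; pose N := [set g | k g \in <<D>>].
  have gN: group_set N.
    apply/group_setP; split=> [|x y]; first by rewrite inE Kaut1 ?group1.
    by rewrite !inE KautM //; apply: groupM.
  suffices /subsetP sDN: <<D>> \subset Group gN by move=> /sDN; rewrite inE.
  rewrite gen_subG; apply/subsetP=> x Dx.
  by rewrite inE mem_gen // bigcup_permP.
have [D1 | DT] := primK (sset_Asubgroup sD) actD.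
  have: X \subset <<D>> by rewrite sub_gen // sub_bigcup_perm.
  by rewrite [<<D>>]D1.
by case/eqP: properW; apply/eqP; rewrite eqEsubset subsetT -DT gen_subG.
Qed.

(** The intersection of the stabilizers of all K-translates of [X] is a K-invariant A-subgroup. It
    contains [B], so it is the whole group. *)
Lemma primitive_stab (B : {group gT}) X :
    [acts K, on B | 'P] -> B :!=: 1 -> sset A X ->
  (forall g b, g \in X -> b \in B -> g * b \in X) -> X != set0 -> X = [set: gT].
Proof.
move=> /actsPerm actB ntB sX stX ntX.
pose I := (\bigcap_(k in K) stabr (k @: X))%G.
have sI : sset A I.
  by apply: sset_bigcap => k Kk; apply/sset_stabr/sset_perm.
have actI : [acts K, on I | 'P].
  apply/actsPerm=> k g Kk /bigcapP Ig; apply/bigcapP=> l Kl.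
  apply/stabrP=> h; rewrite -[h](permKV k) -KautM //.
  have kE y : (k y \in l @: X) = (y \in (l * k^-1) @: X).
    rewrite -[k y in LHS](permKV l) -[y in RHS](permKV (l * k^-1)) !mem_permI.
    by rewrite invMg invgK permM.
  rewrite !kE; have /Ig/stabrP : l * k^-1 \in K by rewrite groupM ?groupV.
  exact.
have sBI : B \subset I.
  apply/subsetP=> b Bb; apply/bigcapP=> k Kk; apply/stabrP=> _ /imsetP[g Xg ->].
  rewrite -[b](permKV k) -KautM // mem_permI stX //.
  by apply: actB; rewrite ?groupV.
have [I1 | IT] := primK (sset_Asubgroup sI) actI.
  by case/eqP: ntB; apply/trivgP; rewrite -I1.
have /set0Pn[x Xx] := ntX; apply/setP=> g; rewrite [RHS]inE.
have /bigcapP/(_ _ (group1 K))/stabrP : x^-1 * g \in I.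
  by have := in_setT (x^-1 * g); rewrite -IT.
have imset_perm1 y : (y \in (1 : {perm gT}) @: X) = (y \in X).
  by rewrite -{1}[y]perm1 mem_permI.
by move=> /(_ x); rewrite !imset_perm1 mulKVg; apply.
Qed.

End InvariantSring.

Lemma dvdn_card_stable (gT : finGroupType) (H : {group gT}) (D : {set gT}) :
  (forall g h, g \in D -> h \in H -> g * h \in D) -> #|H| %| #|D|.
Proof.
move=> sD; have actD : [acts H, on D | 'R].
  apply/subsetP=> h Hh; rewrite !inE /=; apply/subsetP=> g Dg.
  by rewrite inE /= sD.
rewrite -(acts_sum_card_orbit actD); apply: dvdn_sum => _ /imsetP[g _ ->].
by rewrite orbitR card_lcoset.
Qed.

(** * Characters of abelian groups *)

Local Open Scope ring_scope.

Lemma exprD_prime_mod (p : nat) (u v : algC) :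
    prime p -> u \in Aint -> v \in Aint ->
  ((u + v) ^+ p == u ^+ p + v ^+ p %[mod p])%A.
Proof.
move=> p_pr Zu Zv; have p_gt0 := prime_gt0 p_pr.
rewrite exprDn (bigD1 ord0) //= (bigD1 ord_max) /=; last first.
  by rewrite -val_eqE /= -lt0n.
rewrite subn0 subnn !expr0 mulr1 mul1r bin0 binn !mulr1n addrA.
rewrite -[X in eqAmod _ _ X]addr0 eqAmodDl eqAmod0 rpred_sum // => i.
rewrite -!val_eqE /= => /andP[i_gt0 i_ltp].
have /(prime_dvd_bin p_pr)/dvdnP[m ->] : (0 < i < p)%N.
  by rewrite lt0n i_gt0 ltn_neqAle i_ltp -ltnS ltn_ord.
rewrite -mulr_natr natrM mulrA -eqAmod0 eqAmodMl0 //.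
by rewrite !rpredM ?rpredX ?rpred_nat.
Qed.

Lemma Frobenius_sum_mod (p : nat) (I : finType) (C : {set I}) (z : I -> algC) e :
    prime p -> (forall i, z i \in Aint) ->
  ((\sum_(i in C) z i) ^+ (p ^ e)%N == \sum_(i in C) z i ^+ (p ^ e)%N %[mod p])%A.
Proof.
move=> p_pr; have powsum (y : I -> algC) : (forall i, y i \in Aint) ->
    ((\sum_(i in C) y i) ^+ p == \sum_(i in C) y i ^+ p %[mod p])%A.
  (* Integrality of the partial sums is carried through the induction because [exprD_prime_mod]
     requires it. *)
  move=> Zy; suffices [] : \sum_(i in C) y i \in Aint /\
    ((\sum_(i in C) y i) ^+ p == \sum_(i in C) y i ^+ p %[mod p])%A by [].
  elim/big_rec2: _ => [|i s t _ [Zt IHt]].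
    by rewrite expr0n eqn0Ngt prime_gt0.
  split; first by rewrite rpredD.
  apply: eqAmod_trans (exprD_prime_mod p_pr _ _) _ => //.
  by rewrite eqAmodDl.
elim: e z => [|e IHe] z Zz; first by rewrite expn0 expr1 [X in eqAmod _ _ X](eq_bigr z).
have powX (a b : algC) : a \in Aint -> b \in Aint ->
    (a == b %[mod p])%A -> forall n, (a ^+ n == b ^+ n %[mod p])%A.
  move=> Za Zb eq_ab; elim=> [|n IHn] //; rewrite !exprS.
  by apply: eqAmodM => //; rewrite rpredX.
rewrite expnS exprM.
apply: eqAmod_trans (powX _ _ _ _ (powsum z Zz) _) _.
- by rewrite rpredX ?rpred_sum.
- by rewrite rpred_sum // => i _; rewrite rpredX.
under [X in eqAmod _ _ X]eq_bigr do rewrite exprM.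
by apply: IHe => i; rewrite rpredX.
Qed.

Section AbelianCharacters.

Variable gT : finGroupType.
Hypothesis abT : abelian [set: gT].
Local Notation T := [set: gT].

Lemma chi_lin (i : Iirr T) : 'chi_i \is a linear_char.
Proof. exact: (char_abelianP T abT). Qed.

Lemma chiM (i : Iirr T) g h : 'chi_i (g * h)%g = 'chi_i g * 'chi_i h.
Proof. by apply: (lin_charM (chi_lin i)); rewrite inE. Qed.

Lemma chi1 (i : Iirr T) : 'chi_i 1%g = 1.
Proof. exact/lin_char1/chi_lin. Qed.

Lemma chi_neq0 (i : Iirr T) g : 'chi_i g != 0.
Proof. by apply: (lin_char_neq0 (chi_lin i)); rewrite inE. Qed.

Lemma chiV (i : Iirr T) g : 'chi_i g^-1%g = ('chi_i g)^-1.
Proof. by apply: (lin_charV (chi_lin i)); rewrite inE. Qed.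

Lemma chiX (i : Iirr T) g n : 'chi_i (g ^+ n)%g = 'chi_i g ^+ n.
Proof. by apply: (lin_charX (chi_lin i)); rewrite inE. Qed.

Lemma sum_chi g : \sum_(i : Iirr T) 'chi_i g = #|T|%:R *+ (g == 1)%g.
Proof.
rewrite -cfRegE cfReg_sum sum_cfunE; apply: eq_bigr => i _.
by rewrite cfunE chi1 mul1r.
Qed.

Definition Fourier (a : gT -> algC) (i : Iirr T) : algC :=
  \sum_g a g * 'chi_i g.

Lemma Fourier_inv a h :
  \sum_i Fourier a i * 'chi_i h^-1%g = #|T|%:R * a h.
Proof.
under eq_bigr do rewrite mulr_suml.
rewrite exchange_big (bigD1 h) //= [X in _ + X]big1 ?addr0 => [|g neq_gh].
  under eq_bigr do rewrite -mulrA -chiM mulgV chi1 mulr1.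
  by rewrite sumr_const card_Iirr_abelian // mulr_natl.
under eq_bigr do rewrite -mulrA -chiM.
by rewrite -mulr_sumr sum_chi -eq_mulgV1 (negPf neq_gh) mulr0.
Qed.

Lemma Fourier_conv a b i :
  Fourier (fun g => \sum_h a h * b (h^-1 * g)%g) i = Fourier a i * Fourier b i.
Proof.
rewrite /Fourier mulr_suml.
under eq_bigr do rewrite mulr_suml.
rewrite exchange_big /=; apply: eq_bigr => h _.
rewrite mulr_sumr (reindex_inj (mulgI h)) /=; apply: eq_bigr => g _.
by rewrite mulKg chiM -!mulrA; congr (_ * _); rewrite mulrCA.
Qed.

Lemma Fourier_delta i : Fourier (fun g => (g == 1%g)%:R) i = 1.
Proof.
rewrite /Fourier (bigD1 1%g) //= eqxx mul1r chi1 big1 ?addr0 // => g /negPf->.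
by rewrite mul0r.
Qed.

Lemma Fourier_const a :
  (forall i, i != 0 -> Fourier a i = 0) -> forall g h, a g = a h.
Proof.
move=> a0; suffices aE g : #|T|%:R * a g = Fourier a 0.
  by move=> g h; apply: (mulfI (neq0CG T)); rewrite !aE.
rewrite -Fourier_inv (bigD1 0) //= big1 ?addr0 => [|i /a0->].
  by rewrite irr0 cfun1E inE mulr1.
by rewrite mul0r.
Qed.

Lemma sum_mult_char (B : {group gT}) (f : gT -> algC) :
    (forall g h, f (g * h)%g = f g * f h) ->
  (exists2 b, b \in B & f b != 1) -> \sum_(g in B) f g = 0.
Proof.
move=> fM [b Bb nt_fb]; apply/eqP.
have : (f b - 1) * \sum_(g in B) f g == 0.
  rewrite mulrBl mul1r mulr_sumr subr_eq0 eq_sym (reindex_inj (mulgI b)) /=.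
  rewrite (eq_bigl (fun g => g \in B)) => [|g]; last by rewrite groupMl.
  by under eq_bigr do rewrite fM.
by rewrite mulf_eq0 subr_eq0 (negPf nt_fb).
Qed.

Lemma chi_nontrivial (i : Iirr T) : i != 0 -> exists g, 'chi_i g != 1.
Proof.
move=> nt_i; have [/forallP chi1 | ] := boolP [forall g, 'chi_i g == 1].
  case/eqP: nt_i; apply: irr_inj; apply/cfunP=> g.
  by rewrite irr0 cfun1E inE (eqP (chi1 g)).
by rewrite negb_forall => /existsP.
Qed.

Lemma chi_aut (i : Iirr T) (k : {perm gT}) : k \in Aut T ->
  exists j : Iirr T, forall g, 'chi_j (k g) = 'chi_i g.
Proof.
move=> Ak; have isoA : isom T T (autm Ak).
  by apply/isomP; rewrite injm_autm im_autm.
exists (isom_Iirr isoA i) => g; rewrite isom_IirrE -[k g]/(autm Ak g).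
by rewrite cfIsomE ?inE.
Qed.

(** The contragredient action on characters. The default [i] outside [Aut T] keeps the map injective
    for every permutation, as [is_action] demands. *)
Definition aut_act (i : Iirr T) (k : {perm gT}) : Iirr T :=
  odflt i [pick j | (k \in Aut T) && [forall g, 'chi[T]_j (k g) == 'chi_i g]].

Lemma aut_actE i k g : k \in Aut T -> 'chi_(aut_act i k) (k g) = 'chi_i g.
Proof.
move=> Ak; rewrite /aut_act; case: pickP => [j /andP[_ /forallP/(_ g)/eqP] // | ].
have [j chij] := chi_aut i Ak; move/(_ j); rewrite Ak /=.
by move/negP/negP/forallPn=> [h]; rewrite chij eqxx.
Qed.

Lemma aut_act_is_action : is_action (Aut T) aut_act.
Proof.
split=> [k i j | i k l Ak Al].
  have [Ak eq_ij | nAk] := boolP (k \in Aut T); last first.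
    rewrite /aut_act (negPf nAk).
    by do 2!case: pickP => //.
  by apply: irr_inj; apply/cfunP=> g; rewrite -!(aut_actE _ g Ak) eq_ij.
apply: irr_inj; apply/cfunP=> g; rewrite -[g](permKV (k * l)%g).
by rewrite aut_actE ?groupM // permM !aut_actE.
Qed.

Canonical aut_action := Action aut_act_is_action.

End AbelianCharacters.
Local Close Scope ring_scope.

(** * The field case *)

(** [F] is [T] itself and [f] the identity; the existential keeps the new ring structure apart from
    a group structure that [T] may already carry. *)
Lemma finField_of_operations (T : finType) (zero one : T) (opp inv : T -> T)
    (add mul : T -> T -> T) :
    associative add -> commutative add -> left_id zero add ->
    left_inverse zero opp add ->
    associative mul -> commutative mul -> left_id one mul ->
    left_distributive mul add -> one != zero ->
    (forall a, a != zero -> mul (inv a) a = one) -> inv zero = zero ->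
  exists (F : finFieldType) (f : T -> F), [/\ bijective f,
    forall a b, f (add a b) = (f a + f b)%R
  & forall a b, f (mul a b) = (f a * f b)%R].
Proof.
move=> addA addC add0 addN mulA mulC mul1 mulD nz_one mulV inv0.
pose zm := GRing.isZmodule.Build T addA addC add0 addN.
pose Z : zmodType := HB.pack T zm.
pose rm := GRing.Zmodule_isComNzRing.Build Z mulA mulC mul1 mulD nz_one.
pose R : comNzRingType := HB.pack T zm rm.
pose fm := GRing.ComNzRing_isField.Build R mulV inv0.
pose F : finFieldType := HB.pack T zm rm fm.
by exists F, id; split=> //; exists id.
Qed.

(** Put [k x * h := k h], with [x] as unit element. This is well defined because [K] is abelian and
    transitive on the nontrivial elements, so that [k] is determined by [k x]; distributivity holds
    because [K] acts by automorphisms. *)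
Lemma finField_of_regular_action (gT : finGroupType) (K : {group {perm gT}}) (x : gT) :
    abelian [set: gT] -> K \subset Aut [set: gT] -> abelian K -> x != 1 ->
    (forall g, g != 1 -> exists2 k, k \in K & g = k x) ->
  exists (F : finFieldType) (f : gT -> F), [/\ bijective f,
    forall g h, f (g * h) = (f g + f h)%R
  & forall k g, k \in K -> f (k g) = (f (k x) * f g)%R].
Proof.
move=> abT sKAut abK nt_x orbK.
have mulC := abelianT_mulgC abT; have KM := KautM sKAut; have K1 := Kaut1 sKAut.
have Kcomm k l g : k \in K -> l \in K -> k (l g) = l (k g).
  by move=> Kk Kl; rewrite -!permM (centsP abK k).
have Kreg k l g : k \in K -> l \in K -> k x = l x -> k g = l g.
  move=> Kk Kl eqx; have [-> | /orbK[m Km ->]] := eqVneq g 1; first by rewrite !K1.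
  by rewrite !(Kcomm _ m) // eqx.
have Kx k : k \in K -> k x != 1.
  by move=> Kk; rewrite -(K1 k Kk) (inj_eq perm_inj).
(* The group identity is the zero of the field; as [k x] is never [1], the default value is reached
   exactly for [g = 1]. *)
pose mul g h := if [pick k in K | k x == g] is Some k then k h else 1.
have mulK k h : k \in K -> mul (k x) h = k h.
  move=> Kk; rewrite /mul; case: pickP => [l /andP[Kl /eqP eqx] | /(_ k)].
    exact: Kreg.
  by rewrite /= Kk eqxx.
have mul1l h : mul 1 h = 1.
  rewrite /mul; case: pickP => // l /andP[Kl].
  by rewrite (negPf (Kx l Kl)).
have mul1r h : mul h 1 = 1.
  have [-> // | /orbK[k Kk ->]] := eqVneq h 1.
  by rewrite mulK // K1.
have mul_comm : commutative mul.
  move=> a b; have [-> | /orbK[k Kk ->]] := eqVneq a 1; first by rewrite mul1l mul1r.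
  have [-> | /orbK[l Kl ->]] := eqVneq b 1; first by rewrite mul1l mul1r.
  by rewrite !mulK // Kcomm.
(* The default value makes the inverse of zero equal to zero. *)
pose inv g := if [pick k in K | k x == g] is Some k then k^-1 x else 1.
have [] := @finField_of_operations gT 1 x invg inv mulg mul.
- exact: mulgA.
- exact: mulC.
- exact: mul1g.
- exact: mulVg.
- move=> a b c; have [-> | /orbK[k Kk ->]] := eqVneq a 1; first by rewrite !mul1l.
  have [-> | /orbK[l Kl ->]] := eqVneq b 1; first by rewrite mul1r !mul1l mul1r.
  by rewrite !mulK // -[k (l x)]permM mulK ?groupM // permM.
- exact: mul_comm.
- by move=> a; rewrite -{1}[x]perm1 mulK ?group1 ?perm1.
- move=> a b c; rewrite !(mul_comm _ c).
  by have [-> | /orbK[k Kk ->]] := eqVneq c 1; rewrite ?mul1l ?mulg1 ?mulK ?KM.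
- by [].
- move=> a /orbK[k Kk ->]; rewrite /inv; case: pickP => [l|/(_ k)].
    by case/andP=> Kl /eqP eqx; rewrite mulK ?groupV // -eqx permK.
  by rewrite /= Kk eqxx.
- by rewrite /inv; case: pickP => // l /andP[Kl]; rewrite (negPf (Kx l Kl)).
move=> F [f [bij_f fD fM]]; exists F, f; split=> // k g Kk.
by rewrite -fM mulK.
Qed.

(** Membership in an S-ring is a boolean predicate, so the image is defined by pulling functions
    back along [f], not by an existential over [A]. *)
Lemma sring_transport (gT rT : finGroupType) (A : sring gT)
    (f : gT -> rT) (f' : rT -> gT) :
    cancel f f' -> cancel f' f -> {morph f : g h / g * h} ->
  exists2 B : sring rT,
    basic_sets B = [set f @: (X : {set gT}) | X in basic_sets A] & sring_image f A B.
Proof.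
move=> fK f'K fM; have inj_f := can_inj fK.
have f1 : f 1 = 1 by apply: (mulgI (f 1)); rewrite -fM !mulg1.
have fV : {morph f : g / g^-1}.
  by move=> g; apply: (mulgI (f g)); rewrite -fM !mulgV f1.
pose pull (b : int_group_ring rT) : int_group_ring gT := [ffun g => b (f g)].
pose SB := [set f @: (X : {set gT}) | X in basic_sets A].
pose PB : {pred int_group_ring rT} := [pred b | pull b \in sring_pred A].
have inPB b : (b \in PB) = (pull b \in sring_pred A) by [].
have mem_f (X : {set gT}) g : (f g \in f @: X) = (g \in X) by apply: mem_imset.
have pull_xi (X : {set gT}) : pull (xi (f @: X)) = xi X.
  by apply/ffunP=> g; rewrite !ffunE mem_f.
have sum_pull (c : {set rT} -> int) :
    pull (\sum_(Y in SB) xi Y *~ c Y)%R = (\sum_(X in basic_sets A) xi X *~ c (f @: X))%R.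
  apply/ffunP=> g; rewrite ffunE !sum_ffunE big_imset /=; last first.
    by move=> X Y _ _; apply: imset_inj.
  by apply: eq_bigr => X _; rewrite !xi_mulz mem_f.
have pull_inj : injective pull.
  move=> a b /ffunP eqab; apply/ffunP=> y.
  by have := eqab (f' y); rewrite !ffunE f'K.
have [A1 AB AM] := sring_subring A; have [Sxi Sspan Sfree] := sring_basis A.
have PBring : subring_closed PB.
  split=> [|a b|a b]; rewrite !inPB.
  - have -> // : pull 1%R = 1%R.
    by apply/ffunP=> g; rewrite !ffunE -f1 (inj_eq inj_f).
  - have -> : pull (a - b)%R = (pull a - pull b)%R by apply/ffunP=> g; rewrite !ffunE.
    exact: AB.
  have -> : pull (a * b)%R = (pull a * pull b)%R; last exact: AM.
  apply/ffunP=> g; rewrite !ffunE (reindex f) /=; last by exists f'; move=> ? _.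
  by apply: eq_bigr => h _; rewrite !ffunE fM fV.
have PBbasis : is_Zbasis PB SB.
  split=> [_ /imsetP[X SX ->]|a|c c0 _ /imsetP[X SX ->]].
  - by rewrite inPB pull_xi Sxi.
  - rewrite inPB => /Sspan[c defa]; exists (fun Y : {set rT} => c (f' @: Y)).
    apply: pull_inj; rewrite sum_pull defa; apply: eq_bigr => X _.
    by rewrite -imset_comp (eq_imset _ fK) imset_id.
  apply: (Sfree (fun X : {set gT} => c (f @: X))) SX.
  by rewrite -sum_pull c0; apply/ffunP=> g; rewrite !ffunE.
have PBpart : partition SB [set: rT].
  have -> : [set: rT] = f @: [set: gT].
    by apply/setP=> y; rewrite inE; apply/esym/imsetP; exists (f' y).
  by rewrite imset_partition // basic_sets_partition.
have PB1 : [set 1] \in SB.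
  by apply/imsetP; exists [set 1]; rewrite ?basic_sets1 // imset_set1 f1.
have PBV Y : Y \in SB -> Y^-1 \in SB.
  case/imsetP=> X SX ->; apply/imsetP; exists X^-1; first exact: basic_setsV.
  apply/setP=> y; rewrite -[y]f'K inE -fV !mem_f inE //.
exists (SRing PBring PBbasis PBpart PB1 PBV) => //.
move=> b; rewrite [_ \in _]inPB; split=> [Ab | [a Aa ->]].
  exists (pull b) => //; apply/ffunP=> y.
  by rewrite (gr_mapE _ _ fK f'K) ffunE f'K.
suffices -> : pull (gr_map f a) = a by [].
by apply/ffunP=> g; rewrite ffunE (gr_mapE _ _ fK f'K) fK.
Qed.

(** [L] is the stabilizer of the basic set of [x]. As [K] is abelian and transitive off the
    identity, [L] stabilizes every basic set and acts transitively on it. *)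
Lemma cyclotomic_of_regular_action (gT : finGroupType) (A : sring gT)
    (K : {group {perm gT}}) (x : gT) :
    abelian [set: gT] -> K \subset Aut [set: gT] -> K_invariant K A ->
    abelian K -> x != 1 -> (forall g, g != 1 -> exists2 k, k \in K & g = k x) ->
  exists (F : finFieldType) (f : {morphism [set: gT] >-> F})
         (L : {group {perm F}}) (B : sring F),
    [/\ isom [set: gT] [set: F] f,
        transport_perms f K = K_field F,
        cyclotomic_sring L B
      & sring_image f A B].
Proof.
move=> abT sKAut invK abK nt_x orbK.
have [F [f [[f' fK f'K] fD fM]]] := finField_of_regular_action abT sKAut abK nt_x orbK.
have fMg : {morph f : g h / g * h} by exact: fD.
pose fm : {morphism [set: gT] >-> F} := Morphism (fun g h _ _ => fMg g h).
have fmK : cancel fm f' by [].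
have f1 : f 1 = 0%R.
  by apply: (@GRing.addrI _ (f 1)); rewrite -fD mulg1 addr0.
have f_neq0 g : (f g != 0%R) = (g != 1) by rewrite -f1 (inj_eq (can_inj fK)).
have Kx k : k \in K -> k x != 1.
  by move=> Kk; rewrite -(Kaut1 sKAut Kk) (inj_eq perm_inj).
have perm_of (k : {perm gT}) : exists s : {perm F}, forall g, s (f g) = f (k g).
  have inj_s : injective (fun y => f (k (f' y))).
    by move=> y z /(can_inj fK)/perm_inj/(can_inj f'K).
  by exists (perm inj_s) => g; rewrite permE fK.
have K_fieldE (s : {perm F}) :
    reflect (exists2 k, k \in K & forall g, s (f g) = f (k g)) (s \in K_field F).
  apply: (iffP (K_fieldP s)) => [[u nz_u su] | [k Kk sk]].
    have [k Kk def_u] : exists2 k, k \in K & f' u = k x.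
      by apply: orbK; rewrite -f_neq0 f'K.
    by exists k => // g; rewrite su fM // -def_u f'K.
  exists (f (k x)); first by rewrite f_neq0 Kx.
  by move=> y; rewrite -[y in LHS]f'K sk fM // f'K.
pose X := sblock A x.
pose L := ('N(f @: X | 'P) :&: K_field F)%G.
have Kcomm k l g : k \in K -> l \in K -> k (l g) = l (k g).
  by move=> Kk Kl; rewrite -!permM (centsP abK k).
have mem_L (s : {perm F}) : reflect
    (exists k, [/\ k \in K, k x \in X & forall g, s (f g) = f (k g)]) (s \in L).
  rewrite inE; apply: (iffP andP) => [[Ns /K_fieldE[k Kk sk]] | [k [Kk Xkx sk]]].
    exists k; split=> //; have /imsetP[g Xg /(can_inj fK)-> //] : f (k x) \in f @: X.
    rewrite -sk -[s _]/('P%act (f x) s) (astabs_act _ Ns).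
    by rewrite imset_f ?mem_sblock.
  split; last by apply/K_fieldE; exists k.
  rewrite !inE /=; apply/subsetP=> _ /imsetP[g Xg ->]; rewrite inE /= apermE sk.
  rewrite imset_f // /X -(sblock_eq Xkx) (sblock_perm invK) // mem_permI //.
have orbitL g : f @: sblock A g = orbit 'P L (f g).
  apply/setP=> y; apply/imsetP/orbitP => [[h gh ->] | [s Ls <-]]; last first.
    have /mem_L[k [Kk Xkx sk]] := Ls; rewrite /= apermE sk; exists (k g) => //.
    have [-> | /orbK[l Kl ->]] := eqVneq g 1.
      by rewrite (Kaut1 sKAut Kk) mem_sblock.
    by rewrite Kcomm // (sblock_perm invK) // mem_permI.
  have [g1 | /orbK[k Kk def_g]] := eqVneq g 1.
    move: gh; rewrite g1 sblock1 => /set1P->; exists 1; rewrite ?group1 //=.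
    by rewrite apermE perm1.
  have : h != 1.
    apply: contraTneq gh => ->; rewrite sblock_sym sblock1 inE def_g.
    exact: Kx.
  move=> /orbK[l Kl def_h].
  (* With [g = k x] and [h = l x], the element [l * k^-1] carries [g] to [h]; commuting with [k], it
     also keeps [x] in its block. *)
  have Km : l * k^-1 \in K by rewrite groupM ?groupV.
  have mg : (l * k^-1) g = h by rewrite permM def_g (Kcomm l k) // permK -def_h.
  have [s sE] := perm_of (l * k^-1); exists s; last by rewrite /= apermE sE mg.
  apply/mem_L; exists (l * k^-1); split=> //.
  rewrite -(mem_permI k) -/X /X -(sblock_perm invK) // Kcomm // -def_g.
  by rewrite mg.
have [B basicB imB] := sring_transport A fK f'K fMg.
exists F, fm, L, B; split=> //.
- apply/isomP; split; first by apply/injmP=> g h _ _ /(can_inj fK).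
  apply/setP=> y; rewrite [RHS]inE; apply/morphimP.
  by exists (f' y); rewrite ?inE.
- apply/setP=> s; rewrite inE; apply/exists_inP/K_fieldE=> [] [k Kk sk].
    move/forallP: sk => sk; by exists k => // g; apply/eqP/sk.
  by exists k => //; apply/forallP=> g; rewrite sk.
split; first exact: subsetIr.
apply/setP=> Y; rewrite basicB; apply/imsetP/imsetP=> [[Z /basicP[g ->] ->] | [y _ ->]].
  by exists (f g); rewrite ?inE ?orbitL.
exists (sblock A (f' y)); first exact: sblock_basic.
by rewrite orbitL f'K.
Qed.

(** * The local ring structure of the Sylow subgroup *)

Section LocalAction.

Variables (gT : finGroupType) (K : {group {perm gT}}) (p : nat) (P : {group gT}).
Hypotheses (abT : abelian [set: gT]) (sKAut : K \subset Aut [set: gT]).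
Hypotheses (p_pr : prime p) (sylP : p.-Sylow([set: gT]) P).
Variables (x : gT) (H : {group gT}).
Local Notation M := (cap_Aut_Sylow K p).
Local Notation Q := ('O_p^'([set: gT])).
Hypotheses (abM : abelian M) (sHP : H \subset P) (actH : [acts K, on H | 'P]).
Hypothesis defP : P :=: orbit 'P M x :|: H.
Hypothesis disjPH : [disjoint orbit 'P M x & H].

Let KM := KautM sKAut.
Let K1 := Kaut1 sKAut.

Let abmulC := abelianT_mulgC abT.

Lemma char_acts (B : {group gT}) : B \char [set: gT] -> [acts K, on B | 'P].
Proof.
move=> /charP[_ charB]; apply/actsPerm=> k g Kk Bg.
have Ak := subsetP sKAut k Kk.
have <- := charB _ (injm_autm Ak) (im_autm Ak).
by apply/morphimP; exists g; rewrite ?inE.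
Qed.

Lemma pcore_Sylow : 'O_p([set: gT]) = P.
Proof. by apply: normal_Hall_pcore sylP _; rewrite -sub_abelian_normal ?subsetT. Qed.

Lemma actsP_Sylow : [acts K, on P | 'P].
Proof. by rewrite -pcore_Sylow; apply/char_acts/pcore_char. Qed.

Lemma actsP_core : [acts K, on Q | 'P].
Proof. exact/char_acts/pcore_char. Qed.

Lemma Sylow_mul_core : P * Q = [set: gT].
Proof.
have /dprodP[_ defT _ _] := nilpotent_pcoreC p (abelian_nil abT).
by rewrite -pcore_Sylow.
Qed.

Lemma Sylow_core_TI : P :&: Q = 1.
Proof. by rewrite -pcore_Sylow coprime_TIg ?coprime_pcoreC. Qed.

Lemma PQ_decomp g : exists a b, [/\ a \in P, b \in Q & g = a * b].
Proof.
have: g \in P * Q by rewrite Sylow_mul_core inE.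
by case/mulsgP=> a b Pa Qb ->; exists a, b.
Qed.

Lemma M_sub_K : M \subset K.
Proof. exact: subsetIl. Qed.

Lemma inM k : k \in M = (k \in K) && [forall b in Q, k b == b].
Proof.
rewrite !inE; apply: andb_id2l => Kk; apply/subsetP/forall_inP=> [fixk b Qb | fixk b Qb].
  by have := fixk b Qb; rewrite inE /= apermE.
by rewrite inE /= apermE fixk.
Qed.

Lemma M_fix k b : k \in M -> b \in Q -> k b = b.
Proof. by rewrite inM => /andP[_ /forall_inP fixk] /fixk/eqP. Qed.

Lemma M_in_K k : k \in M -> k \in K.
Proof. by move/(subsetP M_sub_K). Qed.

Lemma M_comm k l g : k \in M -> l \in M -> k (l g) = l (k g).
Proof. by move=> Mk Ml; rewrite -!permM (centsP abM k). Qed.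

Lemma orbitMP g : reflect (exists2 k, k \in M & g = k x) (g \in P :\: H).
Proof.
have -> : (g \in P :\: H) = (g \in orbit 'P M x).
  rewrite inE defP inE; case Og: (g \in orbit _ _ _) => /=.
    by rewrite (disjointFr disjPH Og).
  by rewrite andNb.
by apply: (iffP orbitP) => [[k Mk <-] | [k Mk ->]]; exists k.
Qed.

Lemma M_unit k : k \in M -> (k x \in P) && (k x \notin H).
Proof.
by move=> Mk; rewrite andbC -in_setD; apply/orbitMP; exists k.
Qed.

Lemma x_unit : (x \in P) && (x \notin H).
Proof. by have := M_unit (group1 M); rewrite perm1. Qed.

Lemma P_neq1 : P :!=: 1.
Proof.
apply/trivgPn; have /andP[Px Hx] := x_unit; exists x => //.
by apply: contraNneq Hx => ->; apply: group1.
Qed.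

Lemma K_H k h : k \in K -> h \in H -> k h \in H.
Proof. by move/actsPerm: actH; apply. Qed.

(** By commutativity [k] fixes the whole orbit, that is [P :\: H]. This set generates [P], since
    [h = x^-1 * (x * h)] for [h] in [H], and [M] fixes [Q] pointwise. *)
Lemma M_regular k : k \in M -> k x = x -> k = 1.
Proof.
move=> Mk kx; have Kk := M_in_K Mk.
have fixPH a : a \in P :\: H -> k a = a.
  by case/orbitMP=> l Ml ->; rewrite M_comm // kx.
have /andP[Px Hx] := x_unit.
have fixP a : a \in P -> k a = a.
  move=> Pa; case Ha: (a \in H); last by apply: fixPH; rewrite inE Ha.
  apply: (mulgI x); rewrite -{1}kx -KM //; apply: fixPH.
  by rewrite inE groupMr // Hx groupM.
apply/permP=> g; have [a [b [Pa Qb ->]]] := PQ_decomp g.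
by rewrite perm1 KM // fixP // (M_fix Mk).
Qed.

(* The subgroup 1 + H of the unit group M of the local ring P. *)
Definition principal_units : {set {perm gT}} := [set k in M | x^-1 * k x \in H].
Local Notation U := principal_units.

Lemma inU k : (k \in U) = (k \in M) && (x^-1 * k x \in H).
Proof. by rewrite inE. Qed.

Lemma principal_units_group_set : group_set U.
Proof.
apply/group_setP; split=> [|k l]; first by rewrite inU group1 perm1 mulVg group1.
rewrite !inU => /andP[Mk Hk] /andP[Ml Hl]; rewrite groupM //= permM.
have -> : l (k x) = l x * l (x^-1 * k x).
  by rewrite -KM ?(M_in_K Ml) // mulKVg.
by rewrite mulgA groupM // K_H ?M_in_K.
Qed.
Canonical principal_units_group := Group principal_units_group_set.

Lemma U_in_M k : k \in U -> k \in M.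
Proof. by rewrite inU => /andP[]. Qed.

Lemma U_transitive h : h \in H -> exists2 u, u \in U & u x = x * h.
Proof.
move=> Hh; have /andP[Px Hx] := x_unit.
have /orbitMP[k Mk def_k]: x * h \in P :\: H.
  by rewrite inE groupMr // Hx groupM // (subsetP sHP).
by exists k; rewrite // inU Mk -def_k mulKg.
Qed.

(** The map sending [k] to [x^-1 * k x] is a bijection from [U] onto [H], injective by
    [M_regular]. *)
Lemma pgroup_U : p.-group U.
Proof.
have cardU : #|U| = #|H|.
  rewrite -(@card_in_imset _ _ (fun k : {perm gT} => x^-1 * k x)) => [|k l]; last first.
    move=> /U_in_M Mk /U_in_M Ml /mulgI eqx.
    apply/eqP; rewrite eq_mulVg1; apply/eqP; apply: M_regular.
      by rewrite groupM ?groupV.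
    by rewrite permM M_comm ?groupV // -eqx permK.
  congr #|pred_of_set _|; apply/setP=> h; apply/imsetP/idP=> [[k Uk ->] | Hh].
    by move: Uk; rewrite inU => /andP[].
  by have [u Uu ux] := U_transitive Hh; exists u; rewrite // ux mulKg.
rewrite /pgroup cardU; apply: pgroupS sHP _; exact: pHall_pgroup sylP.
Qed.

Variable A : sring gT.
Hypotheses (primK : K_primitive K A) (invK : K_invariant K A).

(** [H * Q] is a proper K-invariant subgroup, so by [primitive_sub] it contains no block other than
    that of [1]; an element outside it has its P-component in the orbit of [x]. *)
Lemma sblock_meets_units g : g != 1 ->
  exists k b, [/\ k \in M, b \in Q & k x * b \in sblock A g].
Proof.
move=> ntg; pose W := (H <*> Q)%G.
have defW : W :=: H * Q.
  apply: cent_joinEr; apply: subset_trans (subsetT _) _.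
    exact: subset_trans abT (centS (subsetT _)).
have actW : [acts K, on W | 'P].
  apply/actsPerm=> k y Kk; rewrite defW => /mulsgP[h b Hh Qb ->].
  by rewrite KM // mem_mulg ?K_H //; move/actsPerm: actsP_core; apply.
(* If [x = h * b], then [b] lies in both [P] and [Q], hence is trivial, and [x] falls into [H]. *)
have properW : W :!=: [set: gT].
  apply: contraTneq (in_setT x) => defT; rewrite -defT defW.
  apply/mulsgP=> [] [h b Hh Qb def_x]; have /andP[Px /negP[]] := x_unit.
  have : b \in P :&: Q.
    by rewrite inE Qb andbT -(groupMl _ (subsetP sHP h Hh)) -def_x.
  by rewrite Sylow_core_TI def_x => /set1P->; rewrite mulg1.
have [sgW | /subsetPn[y gy Wy]] := boolP (sblock A g \subset W).
  have := primitive_sub sKAut invK primK actW properW (sset_sblock g) sgW.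
  by move/subsetP/(_ g (mem_sblock A g)); rewrite inE (negPf ntg).
have [a [b [Pa Qb def_y]]] := PQ_decomp y.
have /orbitMP[k Mk def_a] : a \in P :\: H.
  rewrite inE Pa andbT; apply: contra Wy => Ha.
  by rewrite defW def_y mem_mulg.
by exists k, b; rewrite -def_a -def_y.
Qed.

(** * The case of a p-group with H nontrivial *)

Section LocalRing.

Hypotheses (PT : P :=: [set: gT]) (ntH : H :!=: 1).

Let block := sblock A.
Let B := block x.

Lemma core_trivial : Q = 1.
Proof.
have := Sylow_core_TI.
by rewrite PT setTI.
Qed.

Lemma M_eq_K : M :=: K.
Proof.
apply/setP=> k; rewrite inM; case Kk: (k \in K) => //=.
by apply/forall_inP=> b; rewrite core_trivial => /set1P->; rewrite (Kaut1 sKAut).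
Qed.

Lemma unitsT g : g \notin H -> exists2 k, k \in K & g = k x.
Proof.
move=> Hg; have /(orbitMP)[k Mk ->] : g \in P :\: H.
  by rewrite PT !inE Hg.
by exists k; rewrite -?M_eq_K.
Qed.

Lemma x_notin_H : x \notin H.
Proof. by have /andP[] := x_unit. Qed.

Lemma K_unit k g : k \in K -> (k g \in H) = (g \in H).
Proof.
by move=> Kk; have := actsP actH k Kk g; rewrite /= apermE.
Qed.

Lemma block_conj g : g != 1 -> exists2 k, k \in K & block g = k @: B.
Proof.
move=> ntg; have [k [b [Mk Qb gkb]]] := sblock_meets_units ntg.
have Kk : k \in K by rewrite -M_eq_K.
exists k; rewrite // /block -(sblock_perm invK) // -(sblock_eq gkb).
by move: Qb; rewrite core_trivial => /set1P->; rewrite mulg1.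
Qed.

Let S' := basic_sets A :\ [set 1].

Lemma rank_S' : rk A = #|S'|.+1.
Proof. by rewrite /rk (cardsD1 [set 1]) basic_sets1. Qed.

Lemma mem_S' X : reflect (exists2 k, k \in K & X = k @: B) (X \in S').
Proof.
apply: (iffP idP) => [| [k Kk ->]].
  rewrite !inE => /andP[ntX /basicP[g defX]].
  have [] := @block_conj g; last by move=> k Kk defB; exists k; rewrite ?defX.
  by apply: contraNneq ntX => g1; rewrite defX g1 sblock1.
rewrite -(sblock_perm invK) // !inE sblock_basic andbT.
apply: contraNneq x_notin_H => B1.
have := mem_sblock A (k x); rewrite B1 => /set1P.
by rewrite -(Kaut1 sKAut Kk) => /perm_inj->.
Qed.

(** All members of [S'] are K-translates of [B], so the group order is [1 + #|S'| * #|B|], and [p]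
    divides it. *)
Lemma p_ndvd_S' : ~~ (p %| #|S'|).
Proof.
have := card_partition (basic_sets_partition A).
rewrite (bigD1 [set 1]) ?basic_sets1 //= cards1.
rewrite (eq_bigl (fun X => X \in S')) => [|X]; last by rewrite !inE andbC.
rewrite (eq_bigr (fun=> #|B|)) => [|X /mem_S'[k _ ->]]; last first.
  by rewrite card_imset //; apply: perm_inj.
rewrite sum_nat_const => cardT.
have p_dv : p %| #|[set: gT]|.
  rewrite -PT; have /p_natP[[|n] cardP] := pHall_pgroup sylP.
    by case/eqP: P_neq1; apply: card1_trivg; rewrite cardP.
  by rewrite cardP expnS dvdn_mulr.
apply: contraL p_dv => dvS'; rewrite cardT.
rewrite dvdn_addl ?dvdn_mulr // dvdn1.
by apply: contraTneq p_pr => ->.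
Qed.

(** The p-group [U] acts on [S'], whose size is prime to [p], hence fixes some [k @: B]; since [U]
    commutes with [k], it fixes [B] too. *)
Lemma U_fix_block u : u \in U -> block (u x) = B.
Proof.
move=> Uu; pose UG := principal_units_group.
have actU : [acts UG, on S' | 'P^*].
  apply/subsetP=> l Ul; rewrite !inE /=; apply/subsetP=> X /mem_S'[k Kk ->].
  have Kl : l \in K by rewrite -M_eq_K (U_in_M Ul).
  rewrite inE /=; apply/mem_S'; exists (k * l); first by rewrite groupM.
  rewrite setactE -imset_comp; apply: eq_imset => g /=.
  by rewrite permM apermE.
have pU : p.-group UG by exact: pgroup_U.
have := pgroup_fix_mod pU actU.
have [-> | [X]] := set_0Vmem 'Fix_(S' | 'P^*)(UG).
  by rewrite cards0 mod0n => S'0; case/negP: p_ndvd_S'; apply/eqP.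
rewrite inE => /andP[/mem_S'[k Kk ->] /afixP/(_ u Uu) fixB _].
have Mu := U_in_M Uu; have Ku : u \in K by rewrite -M_eq_K.
have {}fixB : u @: (k @: B) = k @: B by exact: fixB.
apply: (imset_inj (@perm_inj _ k)); rewrite -[RHS]fixB.
rewrite -!(sblock_perm invK) //; congr (sblock A _).
by apply: M_comm; rewrite ?M_eq_K.
Qed.

(** Transitivity of [K] off [H] reduces this to [g = x], where [x * h] is a [U]-translate of [x]. *)
Lemma block_mulH g h : g \notin H -> h \in H -> g * h \in block g.
Proof.
move=> Hg Hh; have [k Kk ->] := unitsT Hg.
have [u Uu ux] : exists2 u, u \in U & u x = x * k^-1 h.
  by apply: U_transitive; rewrite K_unit ?groupV.
rewrite -{1}[h](permKV k) -KM // -ux /block (sblock_perm invK) // mem_permI.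
by rewrite -[sblock A x]/B -(U_fix_block Uu) mem_sblock.
Qed.

Let Y := B :&: H.

(** If [B] avoided [H], it would be stable under [H] and thus, by [primitive_stab], the whole group,
    which contains [1]. *)
Lemma Y_neq0 : Y != set0.
Proof.
apply/eqP=> Y0; have BH g : g \in B -> g \notin H.
  by move=> Bg; apply/negP=> Hg; have := in_set0 g; rewrite -Y0 inE Bg Hg.
have BT : B = [set: gT].
  apply: (primitive_stab sKAut invK primK actH ntH); first exact: sset_sblock.
    move=> g h Bg Hh; rewrite /B /block -(sblock_eq Bg).
    exact: block_mulH (BH g Bg) Hh.
  by apply/set0Pn; exists x; apply: mem_sblock.
by have := BH 1; rewrite BT !group1 => /(_ isT).
Qed.

Let D z := [set h in B :\: H | h^-1 * z \in B :\: H].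

(** [D z] indexes the factorizations of [z] in [B] with both factors outside [H]; replacing the
    factors [g], [g'] by [g * h], [h^-1 * g'] gives another one. *)
Lemma dvd_D z : #|H| %| #|D z|.
Proof.
have stab g h : g \in B :\: H -> h \in H -> g * h \in B :\: H.
  rewrite !inE => /andP[Hg Bg] Hh; rewrite groupMr // Hg.
  by rewrite /B /block -(sblock_eq Bg) block_mulH.
apply: dvdn_card_stable => g h; rewrite ![_ \in D z]inE => /andP[gB zB] Hh.
by rewrite stab //= invMg -mulgA abmulC stab ?groupV.
Qed.

Lemma local_rank2 : rk A = 2.
Proof.
have [k0 Kk0 defB] : exists2 k, k \in K & B = k @: B.
  by exists 1 => //; apply/setP=> y; rewrite -{2}[y]perm1 mem_permI.
have S'B : B \in S' by apply/mem_S'; exists k0.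
rewrite rank_S'; congr _.+1; apply/eqP; rewrite eqn_leq andbC card_gt0.
apply/andP; split; first by apply/set0Pn; exists B.
rewrite leqNgt; apply/negP => S'gt1.
have [Z S'Z neqZ] : exists2 Z, Z \in S' & Z != B.
  have : 0 < #|S' :\ B| by move: S'gt1; rewrite (cardsD1 B) S'B.
  by rewrite card_gt0 => /set0Pn[Z]; rewrite in_setD1 => /andP[]; exists Z.
have [k Kk defZ] := mem_S' _ S'Z.
(* [Y] and its translate lie in the distinct basic sets [B] and [Z], and both are subsets of [H]
   missing [1]. *)
have ltYH : (#|Y| * 2 < #|H|)%N.
  have dis : [disjoint Y & k @: Y].
    rewrite -setI_eq0; apply: contraR neqZ => /set0Pn[y].
    rewrite !inE => /andP[/andP[By _] /imsetP[y' /setIP[By' _] def_y]].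
    rewrite defZ -(sblock_perm invK) //.
    have : y \in k @: B by rewrite def_y mem_permI.
    by rewrite -(sblock_perm invK) // => /sblock_eq <-; rewrite (sblock_eq By).
  have cardYY : #|Y :|: k @: Y| = (#|Y| * 2)%N.
    rewrite cardsU (disjoint_setI0 dis) cards0 subn0 muln2 -addnn.
    by rewrite card_imset //; apply: perm_inj.
  rewrite -cardYY; apply/proper_card/properP; split.
    rewrite subUset subsetIr; apply/subsetP=> _ /imsetP[y /setIP[_ Hy] ->].
    by rewrite K_unit.
  exists 1; rewrite ?group1 //.
  have B1 : 1 \notin B.
    apply: contra x_notin_H => B1; have : x \in sblock A 1 by rewrite sblock_sym.
    by rewrite sblock1 => /set1P->; apply: group1.
  by rewrite !inE negb_or negb_and B1 -(Kaut1 sKAut Kk) mem_permI inE negb_and B1.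
have /set0Pn[y Yy] := Y_neq0; have /setIP[By Hy] := Yy.
have count_eq := sset_count (sset_sblock x) (sset_sblock x) By.
pose c z := [set h in B | h^-1 * z \in B].
(* As [y] is in [H], the two factors are both in [H] or both outside. *)
have cy : #|c y| = (#|c y :&: H| + #|D y|)%N.
  rewrite -(cardsID H (c y)); congr (_ + #|pred_of_set _|)%N.
  by apply/setP=> h; rewrite !inE groupMr // groupV; case: (h \in H).
(* As [x] is not in [H], at most one factor is in [H]. Each element of [Y] occurs once as the first
   and once as the second factor, because the complementary factor is in [x H], hence in [B]. *)
have cx : #|c x| = (#|Y| + (#|Y| + #|D x|))%N.
  rewrite -(cardsID H (c x)) -(cardsID [set h | h^-1 * x \in H] (c x :\: H)).
  congr (_ + (_ + _))%N.
  - congr #|pred_of_set _|; apply/setP=> h; rewrite !inE -andbA.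
    case Bh: (h \in B) => //=.
    case Hh: (h \in H); rewrite ?andbF // andbT abmulC.
    by apply: block_mulH; rewrite ?groupV ?x_notin_H.
  - have <- : #|[set x * h^-1 | h in Y]| = #|Y|.
      by apply: card_imset => h1 h2 /mulgI/invg_inj.
    congr #|pred_of_set _|; apply/setP=> h; apply/idP/imsetP=> [|[h' /setIP[Bh' Hh'] ->]].
      rewrite !inE => /andP[/andP[_ /andP[_ Bhx]] Hhx].
      by exists (h^-1 * x); rewrite ?inE ?Bhx // invMg invgK mulKVg.
    have xh : x * h'^-1 \in B by apply: block_mulH; rewrite ?groupV ?x_notin_H.
    by rewrite !inE xh invMg invgK mulgKV Bh' Hh' groupMr ?groupV // x_notin_H.
  congr #|pred_of_set _|; apply/setP=> h; rewrite !inE.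
  by case: (h \in H); case: (h \in B); case: (_ \in H); case: (_ \in B).
have cyY : (#|c y :&: H| <= #|Y|)%N.
  apply/subset_leq_card/subsetP=> h; rewrite !inE.
  by case/andP=> /andP[-> _] ->.
have /dvdnP[m Dy] := dvd_D y; have /dvdnP[n Dx] := dvd_D x.
have Y_gt0 : (0 < #|Y|)%N by rewrite card_gt0 Y_neq0.
(* Modulo [#|H|] the [D] terms vanish. What remains is smaller than [#|H|], so [#|c y :&: H|] equals
   twice [#|Y|], although it is at most [#|Y|]. *)
have : #|c y| = #|c x| by exact: count_eq.
rewrite cy cx Dy Dx addnA addnn -muln2 => /(congr1 (modn^~ #|H|)).
rewrite ![(_ + _ * #|H|)%N]addnC !modnMDl !modn_small ?(leq_ltn_trans cyY) //; last first.
  by apply: leq_ltn_trans ltYH; rewrite muln2 -addnn leq_addr.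
by move=> eqY; move: cyY; rewrite eqY muln2 -addnn -{3}[#|Y|]addn0 leq_add2l leqNgt Y_gt0.
Qed.

End LocalRing.

(** * The case of a nontrivial p'-core *)

Section NontrivialCore.

Hypothesis ntQ : Q != 1.

Local Open Scope ring_scope.

(** The basic set containing [g] of the S-ring of M-invariant elements of [A]. *)
Definition merged_block g : {set gT} := \bigcup_(k in M) k @: sblock A g.

Let ind g (y : gT) : algC := (y \in merged_block g)%:R.

Lemma sset_merged g : sset A (merged_block g).
Proof. by apply: sset_bigcup_perm invK _ _ M_sub_K _; apply: sset_sblock. Qed.

Lemma merged_M g k y : k \in M -> (k y \in merged_block g) = (y \in merged_block g).
Proof. exact: bigcup_permP. Qed.

(* The classes of this relation are the basic sets of the dual of the S-ring of
   M-invariant elements of A, which the functions [ind g] span. *)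
Let similar (i j : Iirr [set: gT]) := [forall g, Fourier (ind g) j == Fourier (ind g) i].

(* Lagrange interpolation in A, the characters being ring homomorphisms on A. *)
Lemma similar_separation i (s : seq (Iirr [set: gT])) :
    (forall j, j \in s -> ~~ similar i j) ->
  exists e : gT -> algC, [/\ sconst A e,
    forall j, similar i j -> Fourier e j = 1
  & forall j, j \in s -> Fourier e j = 0].
Proof.
have sc_delta : sconst A (fun g => (g == 1%g)%:R : algC).
  by move=> g h gh; have := sset1 gh; rewrite !inE => ->.
elim: s => [_ | j s IHs nsim].
  exists (fun g => (g == 1%g)%:R); split=> // j _; exact: Fourier_delta.
have [|e [sc_e e1 e0]] := IHs.
  by move=> l sl; apply: nsim; rewrite inE sl orbT.
have /forallPn[g neqF] : ~~ similar i j by apply: nsim; rewrite inE eqxx.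
pose d := Fourier (ind g) i - Fourier (ind g) j.
have nz_d : d != 0 by rewrite subr_eq0 eq_sym.
(* The transform of [f] is the interpolation factor: [1] on the class of [i] and [0] at [j].
   Convolving with [e] multiplies the transforms. *)
pose f y := (ind g y - Fourier (ind g) j * (y == 1%g)%:R) / d.
have Ff l : Fourier f l = (Fourier (ind g) l - Fourier (ind g) j) / d.
  rewrite {1}/Fourier; under eq_bigr do rewrite mulrAC.
  rewrite -mulr_suml; congr (_ / d).
  under eq_bigr do rewrite mulrBl -mulrA.
  by rewrite sumrB -mulr_sumr -/(Fourier _ l) -/(Fourier _ l) Fourier_delta ?mulr1.
exists (fun y => \sum_h e h * f (h^-1 * y)%g); split=> [|l sim|l].
- apply: sconst_conv => // y z yz; rewrite /f /ind.
  by rewrite (sset_merged g yz) (sc_delta y z yz).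
- rewrite Fourier_conv // e1 // mul1r Ff.
  by have /forallP/(_ g)/eqP-> := sim; rewrite divff.
rewrite inE Fourier_conv // => /predU1P[->|/e0->]; last by rewrite mul0r.
by rewrite Ff subrr mul0r mulr0.
Qed.

(** Separating [i] from all dissimilar characters gives [e] in [A] whose transform is the indicator
    of the class; Fourier inversion turns the class sum into a multiple of [e g^-1]. *)
Lemma sconst_similar_sum i :
  sconst A (fun g => \sum_(j | similar i j) 'chi_j g).
Proof.
have [j|e [sc_e e1 e0]] := @similar_separation i (enum [pred j | ~~ similar i j]).
  by rewrite mem_enum.
have sumE g : \sum_(j | similar i j) 'chi_j g = #|[set: gT]|%:R * e g^-1%g.
  rewrite -(Fourier_inv abT) invgK big_mkcond /=; apply: eq_bigr => j _.
  have [sim | nsim] := boolP (similar i j); first by rewrite e1 ?mul1r.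
  by rewrite e0 ?mul0r // mem_enum.
move=> g h gh; rewrite !sumE; congr (_ * _).
apply: sc_e; have := sset_inv (sset_sblock (A := A) g^-1%g) gh.
by rewrite !inE mem_sblock.
Qed.

(* [g ^+ N] is the Q-component of [g], and [N] is a power of p. *)
Let N := (#|P| ^ totient #|Q|)%N.

Lemma N_ppower : exists e, N = (p ^ e)%N.
Proof.
have /p_natP[e cardP] := pHall_pgroup sylP.
by exists (e * totient #|Q|)%N; rewrite expnM -cardP.
Qed.

Lemma expgN_Sylow a : a \in P -> (a ^+ N = 1)%g.
Proof.
move=> Pa; apply/eqP; rewrite -order_dvdn (dvdn_trans (order_dvdG Pa)) //.
by rewrite /N -(prednK (_ : 0 < totient #|Q|)%N) ?expnS ?dvdn_mulr ?totient_gt0.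
Qed.

Lemma expgN_core b : b \in Q -> (b ^+ N = b)%g.
Proof.
move=> Qb; rewrite -[RHS]expg1; apply/eqP; rewrite eq_expg_mod_order.
have co : coprime #|P| #|Q|.
  by rewrite -pcore_Sylow coprime_pcoreC.
have dvQ : (#[b] %| #|Q|)%N by apply: order_dvdG.
by rewrite -(modn_dvdm N dvQ) (Euler_exp_totient co) modn_dvdm.
Qed.

(* By Frobenius, [phi (g ^+ N)] is constant modulo p on basic sets, and it is
   P-invariant: its level sets modulo p are P-stable A-sets. *)
Lemma similar_sum_mod i b : b \in Q ->
  (\sum_(j | similar i j) 'chi_j b == \sum_(j | similar i j) 'chi_j 1%g %[mod p])%A.
Proof.
pose phi g := \sum_(j | similar i j) 'chi[[set: gT]]_j g.
have Zchi (j : Iirr [set: gT]) g : 'chi_j g \in Aint by exact: Aint_irr.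
have phiN g : (phi g ^+ N == phi (g ^+ N)%g %[mod p])%A.
  have [e ->] := N_ppower.
  have := Frobenius_sum_mod [set j | similar i j] e p_pr (fun j => Zchi j g).
  rewrite /phi; congr (eqAmod _ (_ ^+ _) _).
    by apply: eq_bigl => j; rewrite inE.
  by apply: eq_big => j; rewrite ?inE // chiX.
pose L := [set g : gT | (phi (g ^+ N)%g == phi 1%g %[mod p])%A].
have sL : sset A L.
  move=> g h gh; rewrite !inE.
  rewrite -(eqAmod_transl _ (phiN g)) -(eqAmod_transl _ (phiN h)).
  by have := @sconst_similar_sum i _ _ gh; rewrite -/(phi h) -/(phi g) => ->.
have LT : L = [set: gT].
  apply: (primitive_stab sKAut invK primK actsP_Sylow P_neq1 sL) => [g a|].
    rewrite !inE => Lg Pa; rewrite expgMn; last exact: abmulC.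
    by rewrite (expgN_Sylow Pa) mulg1.
  by apply/set0Pn; exists 1%g; rewrite inE expg1n.
move=> Qb; have : b \in L by rewrite LT inE.
by rewrite inE expgN_core.
Qed.

(** Pair the class sum with the inverse of [chi_i] over [Q]. Orthogonality gives the size of the
    fiber times [#|Q|]. Modulo [p] the class sum is constant on [Q], so the pairing vanishes because
    [chi_i] is nontrivial there; and [#|Q|] is prime to [p]. *)
Lemma dvdn_similar_fiber i : (exists2 b, b \in Q & 'chi[[set: gT]]_i b != 1) ->
  (p %| #|[set j | similar i j && [forall b in Q, 'chi[[set: gT]]_j b == 'chi_i b]]|)%N.
Proof.
move=> nt_i; set C := [set j | _].
have sumE : \sum_(b in Q) (\sum_(j | similar i j) 'chi_j b) * 'chi_i b^-1%g
            = (#|C| * #|Q|)%:R.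
  under eq_bigr do rewrite mulr_suml.
  rewrite exchange_big /= natrM -[#|C|]sum1_card natr_sum mulr_suml.
  rewrite big_mkcond [RHS]big_mkcond /=; apply: eq_bigr => j _; rewrite inE.
  have [sim | //] := boolP (similar i j).
  have [/forall_inP eqQ | neqQ] := boolP [forall b in Q, 'chi_j b == 'chi_i b].
    rewrite /= mul1r -[#|Q|]sum1_card natr_sum; apply: eq_bigr => b Qb.
    by rewrite (eqP (eqQ b Qb)) -(chiM abT) mulgV chi1.
  rewrite /=; apply: (sum_mult_char (f := fun b => 'chi_j b * 'chi_i b^-1%g)) => [g h|].
    by rewrite !(chiV abT) !(chiM abT) invfM mulrACA.
  have /forall_inPn[b Qb neq_b] := neqQ; exists b => //.
  by rewrite (chiV abT) -[1](divff (chi_neq0 abT i b)) (can_eq (mulfVK _)) ?chi_neq0.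
have : ((#|C| * #|Q|)%:R == 0 %[mod p])%A.
  rewrite -sumE.
  have sum0 : \sum_(b in Q) (\sum_(j | similar i j) 'chi_j 1%g) * 'chi_i b^-1%g = 0.
    rewrite -mulr_sumr (sum_mult_char (f := fun b => 'chi_i b^-1%g)) ?mulr0 //.
      by move=> g h; rewrite !(chiV abT) (chiM abT) invfM.
    by have [b Qb nt_b] := nt_i; exists b^-1%g; rewrite ?groupV // invgK.
  rewrite -[X in eqAmod _ _ X]sum0.
  elim/big_rec2: _ => // b u v Qb eq_uv.
  apply: eqAmodD => //; apply: eqAmodMr; first exact: Aint_irr.
  exact: similar_sum_mod.
have : p^'.-group Q by apply: pcore_pgroup.
rewrite eqAmod0_nat Euclid_dvdM // /pgroup p'natE // => /negbTE->.
by rewrite orbF.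
Qed.

Lemma core_nontrivial (i : Iirr [set: gT]) :
    (forall a, a \in P -> 'chi_i a = 1) -> i != 0 ->
  exists2 b, b \in Q & 'chi_i b != 1.
Proof.
move=> iP /chi_nontrivial[g]; have [a [b [Pa Qb ->]]] := PQ_decomp g.
by rewrite (chiM abT) iP // mul1r; exists b.
Qed.

(** [ind g] is M-invariant; hence [M] preserves the similarity classes of characters. *)
Lemma Fourier_ind_aut g i k : k \in M ->
  Fourier (ind g) (aut_act i k) = Fourier (ind g) i.
Proof.
move=> Mk; rewrite /Fourier (reindex_inj (@perm_inj _ k)) /=.
apply: eq_bigr => y _; rewrite aut_actE ?(subsetP sKAut) ?M_in_K //.
by rewrite /ind merged_M.
Qed.

Lemma extra_similar i : (forall a, a \in P -> 'chi[[set: gT]]_i a = 1) -> i != 0 ->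
  exists j, [/\ similar i j, j != i, forall h, h \in H -> 'chi_j h = 1
     & forall b, b \in Q -> 'chi_j b = 'chi_i b].
Proof.
move=> iP nt_i; have := dvdn_similar_fiber (core_nontrivial iP nt_i).
set C := [set j | _] => dvC.
have sUA : U \subset Aut [set: gT].
  by apply/subsetP=> k Uk; rewrite (subsetP sKAut) ?M_in_K ?U_in_M.
have CP j : reflect (similar i j /\ forall b, b \in Q -> 'chi_j b = 'chi_i b) (j \in C).
  rewrite inE; apply: (iffP andP) => [] [sim eqQ]; split=> //.
    by move=> b Qb; apply/eqP; move/forall_inP: eqQ; apply.
  by apply/forall_inP=> b Qb; rewrite eqQ.
pose UG := principal_units_group.
have actC : [acts UG, on C | aut_action gT].
  apply/subsetP=> k Uk; have Ak := subsetP sUA k Uk.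
  rewrite in_setI Ak inE /=; apply/subsetP=> j /CP[sim eqQ]; rewrite inE.
  apply/CP; split=> [|b Qb].
    apply/forallP=> g; rewrite Fourier_ind_aut ?U_in_M //.
    by move/forallP: sim; apply.
  by rewrite -[b in LHS](M_fix (U_in_M Uk) Qb) aut_actE // eqQ.
have := pgroup_fix_mod pgroup_U actC; rewrite (eqP (dvC : _ %% _ == 0)%N) => /esym/eqP.
(* [chi_i] is trivial on [P], which [U] preserves, and [U] fixes [Q] pointwise. *)
have Fi : i \in 'Fix_(C | aut_action gT)(UG).
  rewrite inE; apply/andP; split; first by apply/CP; split=> //; apply/forallP.
  apply/afixP=> k Uk; apply: irr_inj; apply/cfunP=> g.
  have Ak := subsetP sUA k Uk; have [Mk Kk] := (U_in_M Uk, M_in_K (U_in_M Uk)).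
  rewrite -[g](permKV k) aut_actE //; have [a [b [Pa Qb ->]]] := PQ_decomp (k^-1 g)%g.
  have Pka : k a \in P by move/actsPerm: actsP_Sylow; apply.
  by rewrite KM // !(chiM abT) (M_fix Mk Qb) (iP _ Pka) (iP _ Pa).
rewrite (cardsD1 i) Fi => dvF.
have /set0Pn[j] : 'Fix_(C | aut_action gT)(UG) :\ i != set0.
  apply: contraTneq dvF => ->; rewrite cards0 addn0 -/(dvdn p 1) dvdn1.
  by apply: contraTneq p_pr => ->.
rewrite in_setD1 in_setI => /andP[neq_ji /andP[Cj Fj]].
exists j; have /CP[sim eqQ] := Cj; split=> // h Hh.
(* Invariance of [chi_j] under [u] gives equal values at [x] and [x * h]. *)
have [u Uu ux] := U_transitive Hh.
have := aut_actE j x (subsetP sUA u Uu).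
move/afixP/(_ u Uu): Fj => /= ->; rewrite ux (chiM abT) => /eqP.
by rewrite -[X in _ == X]mulr1 (inj_eq (mulfI (chi_neq0 abT j x))) => /eqP.
Qed.

Lemma sum_Sylow_core (F : gT -> algC) :
  \sum_g F g = \sum_(b in Q) \sum_(a in P) F (a * b)%g.
Proof.
rewrite pair_big /=; pose h (u : gT * gT) := (u.2 * u.1)%g.
have injh : {in setX Q P &, injective h}.
  move=> [b a] [b' a'] /setXP[/= Qb Pa] /setXP[/= Qb' Pa'] eqh.
  rewrite /h /= in eqh.
  have aa' : (a'^-1 * a = b' * b^-1)%g.
    by apply: (canRL (mulgK b)); rewrite -mulgA eqh mulKg.
  have : (a'^-1 * a)%g \in P :&: Q.
    by rewrite inE groupM ?groupV //= aa' groupM ?groupV.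
  rewrite Sylow_core_TI => /set1P a1.
  have ->: a = a' by apply: (mulgI a'^-1%g); rewrite a1 mulVg.
  congr (_, _); apply: (mulIg b^-1%g); by rewrite -aa' a1 mulgV.
transitivity (\sum_(g in h @: setX Q P) F g).
  apply: eq_bigl => g; symmetry; apply/imsetP.
  have [a [b [Pa Qb ->]]] := PQ_decomp g; exists (b, a) => //.
  by rewrite in_setX Qb.
by rewrite big_imset //=; apply: eq_bigl => -[b a]; rewrite in_setX.
Qed.

(** The similar characters [i] and [j] give [ind y] the same transform. The contributions of [H * Q]
    agree, and the rest is the sum in question times [#|P| - #|H|] for [i] and times [- #|H|] for
    [j]; subtracting leaves [#|P|] times the sum. *)
Lemma units_sum_eq0 y (i : Iirr [set: gT]) :
    (forall a, a \in P -> 'chi_i a = 1) -> i != 0 ->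
  \sum_(b in Q) ind y (x * b)%g * 'chi_i b = 0.
Proof.
move=> iP nt_i; have [j [sim neq_ij jH jQ]] := extra_similar iP nt_i.
(* [P :\: H] is a single M-orbit and [M] fixes [b], so the M-invariant [ind y] is constant on the
   translate of [P :\: H] by [b]. *)
have indE a b : a \in P -> a \notin H -> b \in Q -> ind y (a * b)%g = ind y (x * b)%g.
  move=> Pa Ha Qb; have /orbitMP[k Mk ->] : a \in P :\: H by rewrite inE Ha.
  by rewrite /ind -{1}(M_fix Mk Qb) -KM ?M_in_K // merged_M.
have FE (l : Iirr [set: gT]) : (forall h, h \in H -> 'chi_l h = 1) ->
    (forall b, b \in Q -> 'chi_l b = 'chi_i b) ->
    Fourier (ind y) l =
      \sum_(b in Q) (\sum_(h in H) ind y (h * b)%g) * 'chi_i b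
    + (\sum_(a in P) 'chi_l a - #|H|%:R) * \sum_(b in Q) ind y (x * b)%g * 'chi_i b.
  move=> lH lQ; rewrite /Fourier sum_Sylow_core mulr_sumr -big_split /=.
  apply: eq_bigr => b Qb.
  under eq_bigr do rewrite (chiM abT) (lQ b Qb) mulrA.
  rewrite -mulr_suml mulrA -mulrDl; congr (_ * _).
  rewrite [LHS](big_setID H) [X in (X - _) * _](big_setID H) /= (setIidPr sHP).
  rewrite [X in (X + _ - _) * _](eq_bigr (fun=> 1)) => [|h /lH //].
  rewrite sumr_const -[1 *+ _]/(#|H|%:R) addrAC subrr add0r mulr_suml.
  congr (_ + _); first by apply: eq_bigr => h Hh; rewrite lH ?mulr1.
  by apply: eq_bigr => a /setDP[Pa Ha]; rewrite indE // mulrC.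
have jP : \sum_(a in P) 'chi_j a = 0.
  apply: sum_mult_char => [g h|]; first exact: chiM.
  have [/forall_inP jP1|/forall_inPn[a Pa nt_a]] :=
    boolP [forall a in P, 'chi_j a == 1].
    case/eqP: neq_ij; apply: irr_inj; apply/cfunP=> g.
    have [a [b [Pa Qb ->]]] := PQ_decomp g.
    by rewrite !(chiM abT) (jQ _ Qb) (iP _ Pa) (eqP (jP1 a Pa)).
  by exists a.
have iPs : \sum_(a in P) 'chi_i a = #|P|%:R.
  by rewrite (eq_bigr (fun=> 1)) ?sumr_const.
have := FE j jH jQ; have -> : Fourier (ind y) j = Fourier (ind y) i.
  by apply/eqP; move/forallP: sim; apply.
have iH h : h \in H -> 'chi_i h = 1 by move/(subsetP sHP)/iP.
rewrite (FE i) // iPs jP => /addrI/eqP; rewrite -subr_eq0 -mulrBl.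
rewrite opprB addrA subrK subr0 mulf_eq0 (negPf (neq0CG P)) /=.
by move/eqP.
Qed.

(** The function [f] depends only on the Q-component. Its nontrivial Fourier coefficients vanish: by
    [units_sum_eq0] if the character is trivial on [P], and otherwise because the character sums to
    zero over [P]. *)
Lemma units_const y b : b \in Q ->
  ((x * b)%g \in merged_block y) = (x \in merged_block y).
Proof.
move=> Qb; pose f g := ind y (x * g ^+ N)%g.
have fE a b' : a \in P -> b' \in Q -> f (a * b')%g = ind y (x * b')%g.
  move=> Pa Qb'; rewrite /f expgMn; last exact: abmulC.
  by rewrite (expgN_Sylow Pa) mul1g expgN_core.
have f_const : forall g h, f g = f h.
  apply: (Fourier_const abT) => i nt_i.
  have -> : Fourier f i
    = (\sum_(a in P) 'chi_i a) * \sum_(b' in Q) ind y (x * b')%g * 'chi_i b'.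
    rewrite /Fourier sum_Sylow_core mulr_sumr; apply: eq_bigr => b' Qb'.
    rewrite mulr_suml; apply: eq_bigr => a Pa.
    by rewrite fE // (chiM abT) mulrCA.
  have [/forall_inP iP|/forall_inPn[a Pa nt_a]] :=
    boolP [forall a in P, 'chi_i a == 1].
    by rewrite units_sum_eq0 ?mulr0 // => a Pa; apply/eqP/iP.
  rewrite (sum_mult_char (f := 'chi_i)) ?mul0r //; first exact: chiM.
  by exists a.
have := f_const b 1%g; rewrite -[b]mul1g -[X in _ = f X](mulg1 1%g) !fE ?group1 //.
rewrite mulg1 mul1g /ind => /eqP; rewrite eqr_nat.
by do 2!case: (_ \in _).
Qed.

(** The block of [y] contains some [k x * b]; merging over [M] removes [k], and [units_const]
    removes [b]. *)
Lemma x_in_merged y : y != 1%g -> x \in merged_block y.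
Proof.
move=> nt_y; have [k [b [Mk Qb yb]]] := sblock_meets_units nt_y.
rewrite -(units_const y Qb) -(merged_M y _ Mk) KM ?M_in_K // (M_fix Mk Qb).
by apply: subsetP yb; apply: sub_bigcup_perm.
Qed.

(** A nontrivial [z] in [Q] is fixed by [M], so its block is M-stable and already contains [x].
    Every other nontrivial block has an M-translate containing [x], hence coincides with this
    one. *)
Lemma nontrivial_core_rank2 : rk A = 2.
Proof.
have nt_x : x != 1%g.
  by have /andP[_] := x_unit; apply: contraNneq => ->; apply: group1.
have [z Qz nt_z] : exists2 z, z \in Q & z != 1%g by apply/trivgPn.
have zM k : k \in M -> k @: sblock A x = sblock A x.
  have xz : x \in sblock A z.
    have /bigcupP[l Ml] := x_in_merged nt_z.
    by rewrite -(sblock_perm invK) ?M_in_K // (M_fix Ml Qz).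
  move=> Mk; rewrite (sblock_eq xz) -(sblock_perm invK) ?M_in_K //.
  by rewrite (M_fix Mk Qz).
have blockE y : y != 1%g -> sblock A y = sblock A x.
  move=> /x_in_merged/bigcupP[k Mk xy].
  apply: (imset_inj (@perm_inj _ k)); rewrite zM //.
  by move: xy; rewrite -(sblock_perm invK) ?M_in_K // => /sblock_eq->.
have -> : rk A = #|[set [set 1%g]; sblock A x]|.
  congr #|pred_of_set _|; apply/setP=> X; rewrite !inE.
  apply/basicP/orP=> [[y ->] | [/eqP-> | /eqP->]]; last by exists x.
    have [-> | /blockE->] := eqVneq y 1%g; last by right.
    by left; rewrite sblock1.
  by exists 1%g; rewrite sblock1.
rewrite cards2; suffices -> : [set 1%g] != sblock A x by [].
by apply: contraNneq nt_x => eq1; have := mem_sblock A x; rewrite -eq1 inE.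
Qed.

End NontrivialCore.

End LocalAction.

(** * The main result, by cases on [Q] and [H] *)

Theorem theorem1p2 (gT : finGroupType) (K : {group {perm gT}})
    (p : nat) (P : {group gT}) :
  abelian [set: gT] ->
  K \subset Aut [set: gT] ->
  prime p ->
  p.-Sylow([set: gT]) P ->
  abelian (cap_Aut_Sylow K p) ->
  (exists (x : gT) (H : {group gT}),
    [/\ H \subset P,
        [acts K, on H | 'P],
        P :=: orbit 'P (cap_Aut_Sylow K p) x :|: H
      & [disjoint orbit 'P (cap_Aut_Sylow K p) x & H]]) ->
  forall A : sring gT,
    K_primitive K A ->
    K_invariant K A ->
    rk A = 2 \/
    exists (F : finFieldType) (f : {morphism [set: gT] >-> F})
           (L : {group {perm F}}) (B : sring F),
      [/\ isom [set: gT] [set: F] f,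
          transport_perms f K = K_field F,
          cyclotomic_sring L B
        & sring_image f A B].
Proof.
move=> abT sKAut p_pr sylP abM [x [H [sHP actH defP disjPH]]] A primK invK.
have [Q1 | ntQ] := eqVneq 'O_p^'([set: gT]) 1; last first.
  left; exact: (nontrivial_core_rank2 abT sKAut p_pr sylP abM sHP actH defP disjPH).
have PT : P :=: [set: gT].
  by rewrite -(Sylow_mul_core abT sylP) Q1 mulg1.
have [H1 | ntH] := eqVneq (H : {set gT}) 1; last first.
  left; exact: (local_rank2 abT sKAut p_pr sylP abM sHP actH defP disjPH).
right; apply: (cyclotomic_of_regular_action abT sKAut invK (x := x)).
- by rewrite -(M_eq_K abT sKAut sylP PT).
- by have /andP[_] := x_unit defP disjPH; rewrite H1 inE.
move=> g ntg; apply: (unitsT abT sKAut sylP defP disjPH PT).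
by rewrite H1 inE.
Qed.
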